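(* Let $(p_n)$ be a sequence of integers with $1\le p_n\le n$. Suppose that $\pi_n$ has strict exponential decrease: there is a constant $D\in(0,1)$, not depending on $n$, with $\pi_n(p)\le D\,\pi_n(p-1)$ for all $1\le p\le n$. Suppose that the densities $g_S$ have finite second moments and satisfy, for a constant $c_1$ and all $S'\subset S\subset\{1,\dots,n\}$, $$\log g_S(\theta)-\log g_S(\theta')\le c_1|S|+\tfrac1{64}\|\theta-\theta'\|^2\qquad\forall\,\theta,\theta'\in\mathbb{R}^S,$$ $$\bigl|\log g_S(\theta)-\log g_{S'}(\pi_{S'}\theta)\bigr|\le c_1|S|+\tfrac1{64}\|\pi_{S\setminus S'}\theta\|^2\qquad\forall\,\theta\in\mathbb{R}^S .$$ Suppose moreover that there exist constants $C,m_1>0$ and, for any $S_2\subset\{1,\dots,n\}$, a probability density $\gamma_{S_2}$ on $\mathbb{R}^{S_2}$ such that for any $\theta_2\in\mathbb{R}^{S_2}$ and any $S_1\subset S_2^c$, $$\sup_{\theta_1\in\mathbb{R}^{S_1}}\frac{g_{S_1,S_2}(\theta_1,\theta_2)}{g_{S_1}(\theta_1)}\le C\,m_1^{|S_1|+|S_2|}\,\gamma_{S_2}(\theta_2),$$ and that $Dm_1<1$. (The constants $c_1,C,m_1$ do not depend on $n$.) Then: (a) there exists $M>0$ such that, as $p_n,n\to\infty$, $$\sup_{\theta_0\in\ell_0[p_n]}P_{n,\theta_0}\,\Pi_n\bigl(\theta:|S_\theta|>Mp_n\mid X\bigr)\to0;$$ (b) for any $q\in(0,2]$, any $r_n>0$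 satisfying $r_n^2\ge\{p_n\log(n/p_n)\}\vee\log\frac1{\pi_n(p_n)}$, and all sufficiently large $M$, as $p_n,n\to\infty$ such that $p_n/n\to0$, $$\sup_{\theta_0\in\ell_0[p_n]}P_{n,\theta_0}\,\Pi_n\bigl(\theta:d_q(\theta,\theta_0)>Mr_n^q\,p_n^{1-q/2}\mid X\bigr)\to0 .$$
   Context: For $\theta\in\mathbb{R}^n$, $P_{n,\theta}$ denotes the $N_n(\theta,I)$ distribution of $X=(X_1,\dots,X_n)$, with Lebesgue density $p_{n,\theta}$, and $P_{n,\theta}T$ denotes the expectation of $T=T(X)$ under it. The support of $\theta$ is $S_\theta=\{i:\theta_i\ne0\}$; $\ell_0[p]=\{\theta\in\mathbb{R}^n:|S_\theta|\le p\}$; $d_q(\theta,\theta')=\sum_{i=1}^n|\theta_i-\theta_i'|^q$ (no $q$th root); $\|\cdot\|$ is the Euclidean norm; $a\vee b=\max(a,b)$. Prior $\Pi_n$ on $\mathbb{R}^n$: (P1) a dimension $p$ is drawn from a probability measure $\pi_n$ on $\{0,1,\dots,n\}$ with $\pi_n(p)>0$ for every $p$; (P2) given $p$, a subset $S\subset\{1,\dots,n\}$ with $|S|=p$ is drawn uniformly from the $\binom np$ subsets of size $p$; (P3) given $(p,S)$, the vector $\theta_S=(\theta_i:i\in S)$ is drawn from a probability density $g_S$ on $\mathbb{R}^S$ (if $p\ge1$), and the coordinates $\theta_i$, $i\notin S$, are set equal to $0$. The density $g_S$ depends on $S$ only through $|S|$ (identifying $\mathbb{R}^S$ with $\mathbb{R}^{|S|}$);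 by convention $g_\emptyset=1$. Posterior: $\Pi_n(B\mid X)=\int_B p_{n,\theta}(X)\,d\Pi_n(\theta)\big/\int p_{n,\theta}(X)\,d\Pi_n(\theta)$ for Borel $B\subset\mathbb{R}^n$. Notation: $\pi_{S'}\theta=(\theta_i:i\in S')$ is coordinate projection onto $\mathbb{R}^{S'}$. For a partition $S=S_1\cup S_2$ into disjoint sets, with the corresponding partition $\theta=(\theta_1,\theta_2)$ of $\theta\in\mathbb{R}^S$, $g_{S_1,S_2}(\theta_1,\theta_2)=g_S(\theta)$. *)

(* Defs.v *)
From HB Require Import structures.
From mathcomp Require Import all_boot all_order all_algebra.
From mathcomp Require Import all_classical all_reals all_analysis.
From mathcomp Require Import measurable_realfun.
Set Implicit Arguments.
Unset Strict Implicit.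
Unset Printing Implicit Defensive.
Import Order.TTheory GRing.Theory Num.Theory.
Import numFieldNormedType.Exports.
Local Open Scope classical_set_scope.
Local Open Scope ring_scope.

(* R^n is the type [n.-tuple R] with its product (= Borel) sigma-algebra.     *)

Section lebesgue_tuple.
Context {R : realType}.

Section step.
Variables (n : nat) (mu : {sigma_finite_measure set (n.-tuple R) -> \bar R}).

Definition tcons (x : measurableTypeR R * n.-tuple R) : n.+1.-tuple R :=
  [tuple of x.1 :: x.2].

Lemma measurable_tcons : measurable_fun setT tcons.
Proof. exact: measurable_cons. Qed.

Definition lebesgue_tuple_cons : set (n.+1.-tuple R) -> \bar R :=
  pushforward (lebesgue_measure \x mu)%E tcons.

Let ltc0 : lebesgue_tuple_cons set0 = 0%E.
Proof. by rewrite /lebesgue_tuple_cons /pushforward preimage_set0 measure0. Qed.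

Let ltc_ge0 A : (0 <= lebesgue_tuple_cons A)%E.
Proof. by rewrite /lebesgue_tuple_cons /pushforward measure_ge0. Qed.

Let measurable_preimage_tcons A : measurable A -> measurable (tcons @^-1` A).
Proof. by move=> mA; rewrite -[X in measurable X]setTI; exact: measurable_tcons. Qed.

Let ltc_sigma_additive : semi_sigma_additive lebesgue_tuple_cons.
Proof.
move=> F mF tF mUF; rewrite /lebesgue_tuple_cons /pushforward preimage_bigcup.
apply: measure_semi_sigma_additive.
- by move=> i; exact: measurable_preimage_tcons.
- apply/trivIsetP => i j _ _ ij; rewrite -preimage_setI.
  by move/trivIsetP : tF => /(_ _ _ _ _ ij) ->//; rewrite preimage_set0.
- by rewrite -preimage_bigcup; exact: measurable_preimage_tcons.
Qed.

HB.instance Definition _ := isMeasure.Build _ _ _ lebesgue_tuple_cons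
  ltc0 ltc_ge0 ltc_sigma_additive.

Let ltc_sigma_finite : sigma_finite setT lebesgue_tuple_cons.
Proof.
have /sigma_finiteP[F [TF ndF Foo]] := sigma_finiteT (@lebesgue_measure R).
have /sigma_finiteP[G [TG ndG Goo]] := sigma_finiteT mu.
pose uncons (t : n.+1.-tuple R) : measurableTypeR R * n.-tuple R :=
  (tnth t ord0, [tuple of behead t]).
have muncons : measurable_fun setT uncons.
  by apply/measurable_fun_pair; [exact: measurable_tnth|exact: measurable_behead].
have unconsK x : uncons (tcons x) = x.
  by case: x => x t; congr pair; apply/val_inj.
exists (fun k => uncons @^-1` (F k `*` G k)).
  apply/esym; rewrite -subTset => t _.
  have [[k _ Fk] [l _ Gl]] : (\bigcup_k F k) (uncons t).1 /\
      (\bigcup_k G k) (uncons t).2 by rewrite -TF -TG.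
  exists (maxn k l) => //; split.
    by move: Fk; exact/subsetPset/ndF/leq_maxl.
  by move: Gl; exact/subsetPset/ndG/leq_maxr.
move=> k; have [mF Fk] := Foo k; have [mG Gk] := Goo k; split.
  by rewrite -[X in measurable X]setTI; apply: muncons => //; exact: measurableX.
rewrite /lebesgue_tuple_cons /pushforward -comp_preimage.
rewrite (_ : uncons \o tcons = id); last by apply/funext => x; exact: unconsK.
by rewrite preimage_id product_measure1E// lte_mul_pinfty// ge0_fin_numE.
Qed.

HB.instance Definition _ := Measure_isSigmaFinite.Build _ _ _
  lebesgue_tuple_cons ltc_sigma_finite.

End step.

(* Lebesgue measure on R^n; for n = 0 it is the unit mass on the one-point    *)
(* space, so that the only probability density on R^0 is the constant 1.      *)
Fixpoint lebesgue_tuple n : {sigma_finite_measure set (n.-tuple R) -> \bar R} :=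
  match n with
  | 0 => dirac ([tuple] : 0.-tuple R)
  | m.+1 => lebesgue_tuple_cons (lebesgue_tuple m)
  end.

End lebesgue_tuple.

Section vectors.
Context {R : realType}.
Implicit Types n : nat.

Definition tsub n (t u : n.-tuple R) : n.-tuple R :=
  [tuple tnth t i - tnth u i | i < n].

Definition enorm n (t : n.-tuple R) : R :=
  Num.sqrt (\sum_(i < n) tnth t i ^+ 2).

Definition dq (q : R) n (t u : n.-tuple R) : R :=
  \sum_(i < n) `|tnth t i - tnth u i| `^ q.

Definition supp n (t : n.-tuple R) : {set 'I_n} :=
  [set i | tnth t i != 0]%SET.

Definition l0 n (p : nat) : set (n.-tuple R) := [set t | (#|supp t| <= p)%N].

(* For S : {set 'I_n}, the space R^S is represented by [#|S|.-tuple R], the   *)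
(* coordinates being listed in increasing order of their index in S.          *)

(* coordinate projection R^n -> R^S *)
Definition coord_proj n (S : {set 'I_n}) (t : n.-tuple R) : #|S|.-tuple R :=
  [tuple tnth t (enum_val k) | k < #|S|].

(* the injection R^S -> R^n setting the coordinates outside S to 0: if i is   *)
(* not in S then [index i (enum S) = #|S|], and [nth] returns its default 0   *)
Definition extend0 n (S : {set 'I_n}) (t : #|S|.-tuple R) : n.-tuple R :=
  [tuple nth 0 t (index i (enum S)) | i < n].

Lemma measurable_extend0 n (S : {set 'I_n}) :
  measurable_fun setT (@extend0 n S).
Proof.
apply/measurable_fun_tnthP => i.
have [iS|iS] := boolP (i \in S); last first.
  rewrite (_ : _ \o _ = cst 0)//; apply/funext => t /=.
  by rewrite tnth_mktuple nth_default// size_tuple cardE leqNgt index_mem mem_enum.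
have iS' : (index i (enum S) < #|S|)%N by rewrite cardE index_mem mem_enum.
rewrite (_ : _ \o _ = @tnth #|S| R ^~ (Ordinal iS')).
  exact: measurable_tnth.
by apply/funext => t /=; rewrite tnth_mktuple (tnth_nth 0).
Qed.

End vectors.

Section densities.
Context {R : realType}.

Record prob_density n := ProbDensity {
  prob_density_fun :> n.-tuple R -> R;
  prob_density_ge0 : forall t, 0 <= prob_density_fun t;
  measurable_prob_density : measurable_fun setT prob_density_fun;
  integral_prob_density :
    (\int[lebesgue_tuple n]_t (prob_density_fun t)%:E = 1)%E }.

Definition second_moment n (f : prob_density n) : \bar R :=
  (\int[lebesgue_tuple n]_t (enorm t ^+ 2 * f t)%:E)%E.

End densities.
Arguments prob_density R n : clear implicits.

Section normal_tuple.
Context {R : realType} (n : nat) (theta : n.-tuple R).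

Definition normal_tuple_pdf (x : n.-tuple R) : R :=
  \prod_(i < n) normal_pdf (tnth theta i) 1 (tnth x i).

Lemma normal_tuple_pdf_ge0 x : 0 <= normal_tuple_pdf x.
Proof. by apply: prodr_ge0 => i _; exact: normal_pdf_ge0. Qed.

Lemma measurable_normal_tuple_pdf : measurable_fun setT normal_tuple_pdf.
Proof.
apply: measurable_prod => i _.
apply: (measurableT_comp (measurable_normal_pdf _ _)).
exact: measurable_tnth.
Qed.

(* the distribution N_n(theta, I) *)
Definition normal_tuple (A : set (n.-tuple R)) : \bar R :=
  (\int[lebesgue_tuple n]_(x in A) (normal_tuple_pdf x)%:E)%E.

Let normal_tuple0 : normal_tuple set0 = 0%E.
Proof. exact: integral_set0. Qed.

Let normal_tuple_ge0 A : (0 <= normal_tuple A)%E.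
Proof. by apply: integral_ge0 => x _; rewrite lee_fin normal_tuple_pdf_ge0. Qed.

Let normal_tuple_sigma_additive : semi_sigma_additive normal_tuple.
Proof.
apply: semi_sigma_additive_nng_induced.
  by apply/measurable_EFinP; exact: measurable_normal_tuple_pdf.
by move=> x; rewrite lee_fin normal_tuple_pdf_ge0.
Qed.

HB.instance Definition _ := isMeasure.Build _ _ _ normal_tuple
  normal_tuple0 normal_tuple_ge0 normal_tuple_sigma_additive.

End normal_tuple.

Section normal_tuple_probability.
Context {R : realType}.

Lemma integral_normal_tuple_pdf n (theta : n.-tuple R) :
  (\int[lebesgue_tuple n]_x (normal_tuple_pdf theta x)%:E = 1)%E.
Proof.
elim: n theta => [|n IH] theta.
  rewrite /= integral_dirac//=; last first.
    by apply/measurable_EFinP; exact: measurable_normal_tuple_pdf.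
  by rewrite diracT mul1e /normal_tuple_pdf big_ord0.
rewrite (_ : \int[_]_x _ = \int[pushforward (lebesgue_measure \x lebesgue_tuple n)
  (@tcons R n)]_x (normal_tuple_pdf theta x)%:E)%E//.
rewrite ge0_integral_pushforward//=; last 3 first.
- exact: measurable_tcons.
- by apply/measurable_EFinP; exact: measurable_normal_tuple_pdf.
- by move=> x _; rewrite lee_fin normal_tuple_pdf_ge0.
rewrite preimage_setT fubini_tonelli1//=; last 2 first.
- apply/measurable_EFinP.
  apply: (measurableT_comp (measurable_normal_tuple_pdf theta)).
  exact: measurable_tcons.
- by move=> x; rewrite lee_fin normal_tuple_pdf_ge0.
rewrite /fubini_F -[RHS](integral_normal_pdf (tnth theta ord0) 1).
apply: eq_integral => x _.
pose theta' : n.-tuple R := [tuple of behead theta].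
have pdfE (y : n.-tuple R) : normal_tuple_pdf theta (tcons (x, y)) =
    normal_pdf (tnth theta ord0) 1 x * normal_tuple_pdf theta' y.
  rewrite /normal_tuple_pdf big_ord_recl/= tnth0; congr (_ * _).
  apply: eq_bigr => i _; rewrite tnthS.
  by rewrite [in LHS](tuple_eta theta) tnthS.
under eq_integral => y _ do rewrite pdfE EFinM.
rewrite ge0_integralZl_EFin ?normal_pdf_ge0//.
- by rewrite IH mule1.
- by move=> y _; rewrite lee_fin normal_tuple_pdf_ge0.
- by apply/measurable_EFinP; exact: measurable_normal_tuple_pdf.
Qed.

Let normal_tupleT n (theta : n.-tuple R) : normal_tuple theta setT = 1%E.
Proof. exact: integral_normal_tuple_pdf. Qed.

HB.instance Definition _ n (theta : n.-tuple R) :=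
  @Measure_isProbability.Build _ _ R (normal_tuple theta) (normal_tupleT theta).

End normal_tuple_probability.

Record dim_prior (R : realType) n := DimPrior {
  dim_prior_fun :> nat -> R;
  dim_prior_gt0 : forall p, (p <= n)%N -> 0 < dim_prior_fun p;
  dim_prior_sum1 : \sum_(p < n.+1) dim_prior_fun p = 1 }.

Section posterior.
Context {R : realType} (n : nat).
Variables (w : dim_prior R n) (g : forall k, prob_density R k).

(* the law of theta when |S| = p is drawn from w, S is uniform given p, and   *)
(* theta_S has density [g #|S|] given S: each set S has weight w p / 'C(n, p) *)
Definition prior (A : set (n.-tuple R)) : \bar R :=
  (\sum_(S : {set 'I_n}) (w #|S| / 'C(n, #|S|)%:R)%:E *
    \int[lebesgue_tuple #|S|]_(t in @extend0 R n S @^-1` A) (g #|S| t)%:E)%E.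

Let weight_ge0 (S : {set 'I_n}) : 0 <= w #|S| / 'C(n, #|S|)%:R.
Proof.
rewrite divr_ge0// ltW// dim_prior_gt0//.
by rewrite -[leqRHS]card_ord max_card.
Qed.

Let prior0 : prior set0 = 0%E.
Proof.
by rewrite /prior big1// => S _; rewrite preimage_set0 integral_set0 mule0.
Qed.

Let slab_ge0 (S : {set 'I_n}) A :
  (0 <= \int[lebesgue_tuple #|S|]_(t in A) (g #|S| t)%:E)%E.
Proof. by apply: integral_ge0 => t _; rewrite lee_fin prob_density_ge0. Qed.

Let prior_ge0 A : (0 <= prior A)%E.
Proof. by apply: sume_ge0 => S _; rewrite mule_ge0// lee_fin. Qed.

Let prior_sigma_additive : semi_sigma_additive prior.
Proof.
move=> F mF tF mUF.
have mpre (S : {set 'I_n}) A : measurable A -> measurable (@extend0 R n S @^-1` A).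
  by move=> mA; rewrite -[X in measurable X]setTI; exact: measurable_extend0.
rewrite [X in X @ _](_ : _ = fun k => (\sum_(S : {set 'I_n})
    (w #|S| / 'C(n, #|S|)%:R)%:E * \sum_(0 <= i < k)
      \int[lebesgue_tuple #|S|]_(t in @extend0 R n S @^-1` F i) (g #|S| t)%:E)%E);
  last first.
  apply/funext => k; rewrite /prior exchange_big/=; apply: eq_bigr => S _.
  by rewrite ge0_sume_distrr.
apply: cvg_nnesum => S _.
  by apply: nearW => k; rewrite mule_ge0 ?lee_fin// sume_ge0.
apply: cvgeZl => //.
have := @semi_sigma_additive_nng_induced _ _ _ (lebesgue_tuple #|S|)
  (fun t => (g #|S| t)%:E).
move=> /(_ _ _ (fun i => @extend0 R n S @^-1` F i)); rewrite preimage_bigcup; apply.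
- by apply/measurable_EFinP; exact: measurable_prob_density.
- by move=> t; rewrite lee_fin prob_density_ge0.
- by move=> i; exact: mpre.
- apply/trivIsetP => i j _ _ ij; rewrite -preimage_setI.
  by move/trivIsetP : tF => /(_ _ _ _ _ ij) ->//; rewrite preimage_set0.
- by rewrite -preimage_bigcup; exact: mpre.
Qed.

HB.instance Definition _ := isMeasure.Build _ _ _ prior
  prior0 prior_ge0 prior_sigma_additive.

Let priorT : prior setT = 1%E.
Proof.
rewrite /prior; under eq_bigr => S _ do
  rewrite preimage_setT integral_prob_density mule1.
rewrite sumEFin -[in RHS](dim_prior_sum1 w); congr EFin.
have Sn (S : {set 'I_n}) : (#|S| < n.+1)%N.
  by rewrite ltnS -[leqRHS]card_ord max_card.
rewrite (partition_big (fun S : {set 'I_n} => Ordinal (Sn S)) xpredT)//=.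
apply: eq_bigr => p _.
rewrite (eq_bigr (fun=> w p / 'C(n, p)%:R)); last first.
  by move=> S /eqP <-.
transitivity (\sum_(S in [set S : {set 'I_n} | #|S| == p]%SET) (w p / 'C(n, p)%:R)).
  by apply: eq_bigl => S; rewrite finset.inE -val_eqE.
rewrite sumr_const card_draws card_ord -[LHS]mulr_natr divfK//.
by rewrite pnatr_eq0 -lt0n bin_gt0 -ltnS.
Qed.

HB.instance Definition _ := @Measure_isProbability.Build _ _ R prior priorT.

Definition posterior (x : n.-tuple R) (B : set (n.-tuple R)) : R :=
  (\int[prior]_(t in B) normal_tuple_pdf t x) /
  (\int[prior]_t normal_tuple_pdf t x).

End posterior.

(* Main.v *)
(** Write [w_S] for the prior mass of the support [S] and [A_S(x)] for the integral
    of the likelihood against the slab on [R^S]; the posterior is a ratio of sums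
    of [w_S A_S].

    Dimension.  Let [S0] be the true support and split [S] into [S1] inside and
    [S2] outside [S0].  Coordinatewise, [p_theta p_theta0 = p_theta1 p_(theta0 + theta2)],
    so the ratio condition on the slabs gives
    [p_theta0 A_S <= C m1^|S| A_S1 G_S2] with [G_S2(x)] the mixture of
    [p_(theta0 + theta2)(x)] over [gamma_S2], a probability density in [x].
    Summing over [S1] reconstitutes the denominator, and what remains after taking
    the expectation is a geometric sum of ratio [D m1 (1 + delta)].

    Distance.  Put [W(x) = prod_i (1 + (p/n) exp((x_i - theta0_i)^2 / 4))], so that
    [W] has mean at most [exp (2 p)]. Where [W <= exp (3 p)], the noise on any set [T]
    of coordinates is at most [4 (|T| log (n/p) + 3 p)]; the likelihood ratio is then
    at most [exp (r^2 O(1) - |theta - theta0|^2 / 4)] uniformly over low-dimensional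
    [theta], while the denominator is bounded below through a single support of
    size [p] containing [S0].  Elsewhere the posterior is at most [1 <= W exp (- 3 p)].
    The tangent to the concave map [y |-> y^(q/2)] turns the squared Euclidean
    distance into [d_q]. *)

Require Import Defs.
From mathcomp Require Import all_boot all_order all_algebra.
From mathcomp Require Import all_classical all_reals all_analysis.
From mathcomp Require Import measurable_realfun ring lra.
Set Implicit Arguments.
Unset Strict Implicit.
Unset Printing Implicit Defensive.
Import Order.TTheory GRing.Theory Num.Theory.
Import numFieldNormedType.Exports.
Import HBNNSimple.
Local Open Scope classical_set_scope.
Local Open Scope ring_scope.

(** * Integration against finite mixtures of images of measures with densities *)

Section mixture.
Context {R : realType}.
Local Open Scope ereal_scope.

(** The integral of a nonnegative function is a supremum over the simple functions below it, hence
    monotone even among nonmeasurable functions. The posterior, as a function of the data, is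
    handled through this form. *)
Lemma le_ge0_integral d (T : measurableType d) (mu : {measure set T -> \bar R})
    (f1 f2 : T -> \bar R) :
  (forall x, 0 <= f1 x) -> (forall x, f1 x <= f2 x) ->
  \int[mu]_x f1 x <= \int[mu]_x f2 x.
Proof.
move=> f10 f12; have f20 x : 0 <= f2 x by exact: le_trans (f12 x).
rewrite !ge0_integralTE//; apply: le_ereal_sup => _ [h hf <-].
by exists h => //= x; exact: le_trans (hf x) (f12 x).
Qed.

Lemma integral_nnsfun_density d d' (X : measurableType d) (Y : measurableType d')
    (mu : {measure set X -> \bar R}) (phi : X -> Y) (f : X -> R)
    (h : {nnsfun Y >-> R}) :
  measurable_fun setT phi -> measurable_fun setT f -> (forall x, (0 <= f x)%R) ->
  \int[mu]_x ((h (phi x))%:E * (f x)%:E) =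
  \sum_(y \in range h) y%:E * \int[mu]_(x in phi @^-1` (h @^-1` [set y])) (f x)%:E.
Proof.
move=> mphi mf f0.
have mpre y : measurable (phi @^-1` (h @^-1` [set y])).
  by rewrite -[X in measurable X]setTI; exact: mphi.
transitivity (\int[mu]_x \sum_(y \in range h)
    (y%:E * ((f x)%:E * (\1_(phi @^-1` (h @^-1` [set y])) x)%:E))).
  apply: eq_integral => x _; rewrite fimfunE -fsumEFin// muleC.
  rewrite !fsbig_finite// ge0_sume_distrr; last first.
    by move=> y _; rewrite nnfun_muleindic_ge0.
  by apply: eq_bigr => y _; rewrite EFinM muleCA; congr (_ * (_ * _)).
have mg y : measurable_fun setT
    (fun x => (f x)%:E * (\1_(phi @^-1` (h @^-1` [set y])) x)%:E).
  by apply: emeasurable_funM; exact/measurable_EFinP.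
have g0 y x : 0 <= (f x)%:E * (\1_(phi @^-1` (h @^-1` [set y])) x)%:E.
  by rewrite mule_ge0// lee_fin ?f0// indicE ler0n.
transitivity (\sum_(y \in range h) \int[mu]_x (y%:E *
    ((f x)%:E * (\1_(phi @^-1` (h @^-1` [set y])) x)%:E))).
  rewrite -ge0_integral_fsum//.
  - by move=> y; apply: measurable_funeM.
  - move=> y x _; rewrite [in leRHS]muleCA mule_ge0// ?lee_fin ?f0//.
    by have := nnfun_muleindic_ge0 h y (phi x); rewrite lee_fin !indicE.
apply: eq_fsbigr => y /set_mem [z _ <-].
rewrite ge0_integralZl//; last by rewrite lee_fin.
congr (_ * _); rewrite [RHS]integral_mkcond; apply: eq_integral => x _.
by rewrite epatch_indic.
Qed.

(** Simple functions first, then increasing simple approximations with monotone convergence on both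
    sides. It serves both the prior, with one component per support, and the normal law, with a
    single component. *)
Lemma ge0_integral_mixture d (T : measurableType d)
    (nu : {measure set T -> \bar R}) (I : finType) (k : I -> nat) (c : I -> R)
    (phi : forall i, (k i).-tuple R -> T) (f : forall i, (k i).-tuple R -> R) :
  (forall i, (0 <= c i)%R) -> (forall i, measurable_fun setT (phi i)) ->
  (forall i, measurable_fun setT (f i)) -> (forall i t, (0 <= f i t)%R) ->
  (forall A, measurable A -> nu A = \sum_i (c i)%:E *
     \int[lebesgue_tuple (k i)]_(t in phi i @^-1` A) (f i t)%:E) ->
  forall h : T -> \bar R, measurable_fun setT h -> (forall x, 0 <= h x) ->
  \int[nu]_x h x = \sum_i (c i)%:E *
     \int[lebesgue_tuple (k i)]_t (h (phi i t) * (f i t)%:E).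
Proof.
move=> c0 mphi mf f0 nuE h mh h0.
have simpleE (s : {nnsfun T >-> R}) : \int[nu]_x (s x)%:E = \sum_i (c i)%:E *
    \int[lebesgue_tuple (k i)]_t ((s (phi i t))%:E * (f i t)%:E).
  rewrite integralT_nnsfun sintegralE fsbig_finite//=.
  transitivity (\sum_i \sum_(y <- finmap.enum_fset (fset_set (range s))) (c i)%:E * (y%:E *
      \int[lebesgue_tuple (k i)]_(t in phi i @^-1` (s @^-1` [set y])) (f i t)%:E));
    last first.
    apply: eq_bigr => i _.
    rewrite (integral_nnsfun_density _ _ (mphi i) (mf i) (f0 i)) fsbig_finite//= !big_seq ge0_sume_distrr//.
    move=> y; rewrite in_fset_set// => /set_mem [z _ <-].
    by rewrite mule_ge0 ?lee_fin// integral_ge0// => t _; rewrite lee_fin.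
  rewrite exchange_big/=; apply: eq_big_seq => y.
  rewrite in_fset_set// => /set_mem [z _ <-].
  rewrite nuE; last exact: measurable_funPTI.
  rewrite ge0_sume_distrr; last first.
    move=> i _; apply: mule_ge0; rewrite ?lee_fin//.
    by apply: integral_ge0 => t _; rewrite lee_fin.
  by apply: eq_bigr => i _; rewrite muleCA.
pose a := nnsfun_approx measurableT mh.
have acvg x : (a n x)%:E @[n --> \oo] --> h x.
  by apply: cvg_nnsfun_approx => // y _; exact: h0.
have and_ x : {homo (fun n => a n x) : m n / (m <= n)%N >-> (m <= n)%R}.
  by move=> m n mn; exact/lefP/nd_nnsfun_approx.
have H1 : \int[nu]_x (a n x)%:E @[n --> \oo] --> \int[nu]_x h x.
  rewrite (_ : \int[nu]_x h x = \int[nu]_x limn (fun n => (a n x)%:E)).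
    apply: cvg_monotone_convergence => //.
    - by move=> n; exact/measurable_EFinP/measurable_funP.
    - by move=> n x _; rewrite lee_fin.
    - by move=> x _ m n mn; rewrite lee_fin and_.
  by apply: eq_integral => x _; apply/esym/cvg_lim => //; exact: acvg.
suff H2 : \int[nu]_x (a n x)%:E @[n --> \oo] --> \sum_i (c i)%:E *
    \int[lebesgue_tuple (k i)]_t (h (phi i t) * (f i t)%:E).
  exact: cvg_unique H1 H2.
under eq_fun do rewrite simpleE.
have af0 n i (t : (k i).-tuple R) : 0 <= (a n (phi i t))%:E * (f i t)%:E.
  by rewrite mule_ge0// lee_fin.
apply: cvg_nnesum => i _.
  by apply: nearW => n; rewrite mule_ge0 ?lee_fin// integral_ge0.
apply: cvgeZl => //.
rewrite (_ : \int[_]_t (h (phi i t) * (f i t)%:E) =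
    \int[lebesgue_tuple (k i)]_t limn (fun n => (a n (phi i t))%:E * (f i t)%:E)).
  apply: cvg_monotone_convergence.
  - exact: measurableT.
  - move=> n; apply: emeasurable_funM; last by apply/measurable_EFinP; exact: mf.
    by apply/measurable_EFinP; apply: measurableT_comp; [|exact: mphi].
  - by [].
  - by move=> t _ m n mn; rewrite lee_wpmul2r ?lee_fin ?and_.
apply: eq_integral => t _; apply/esym/cvg_lim => //.
by apply: cvgeZr => //; exact: acvg.
Qed.

End mixture.

(** * Tonelli on R^n, one coordinate at a time *)

Section lebesgue_tuple_integral.
Context {R : realType}.
Local Open Scope ereal_scope.

Lemma integral_lebesgue_tuple0 (f : 0.-tuple R -> \bar R) :
  measurable_fun setT f -> \int[lebesgue_tuple 0]_t f t = f [tuple].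
Proof. by move=> mf; rewrite /= integral_dirac//= diracT mul1e. Qed.

Lemma measurable_tcons_section n (f : n.+1.-tuple R -> \bar R) x :
  measurable_fun setT f -> measurable_fun setT (fun t => f (tcons (x, t))).
Proof.
move=> mf; apply: (measurableT_comp mf).
apply: (measurableT_comp (@measurable_tcons R n)).
exact: measurable_pair1.
Qed.

Lemma integral_lebesgue_tupleS n (f : n.+1.-tuple R -> \bar R) :
  measurable_fun setT f -> (forall t, 0 <= f t) ->
  \int[lebesgue_tuple n.+1]_t f t =
  \int[lebesgue_measure]_x \int[lebesgue_tuple n]_t f (tcons (x, t)).
Proof.
move=> mf f0.
rewrite (_ : \int[_]_t _ =
  \int[pushforward (lebesgue_measure \x lebesgue_tuple n) (@tcons R n)]_t f t)//.
rewrite ge0_integral_pushforward//=; last exact: measurable_tcons.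
rewrite preimage_setT fubini_tonelli1//.
by apply: (measurableT_comp mf); exact: measurable_tcons.
Qed.

Lemma integral_lebesgue_tuple_prod n (h : 'I_n -> R -> R) :
  (forall i, measurable_fun setT (h i)) -> (forall i y, (0 <= h i y)%R) ->
  \int[lebesgue_tuple n]_t (\prod_(i < n) h i (tnth t i))%:E =
  \prod_(i < n) \int[lebesgue_measure]_y (h i y)%:E.
Proof.
elim: n h => [|n IH] h mh h0.
  have -> : (fun t : 0.-tuple R => (\prod_(i < 0) h i (tnth t i))%:E) = cst 1.
    by apply/funext => t; rewrite big_ord0.
  by rewrite integral_lebesgue_tuple0// big_ord0.
have mp m (k : 'I_m -> R -> R) : (forall i, measurable_fun setT (k i)) ->
    measurable_fun setT (fun t : m.-tuple R => (\prod_(i < m) k i (tnth t i))%:E).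
  move=> mk; apply/measurable_EFinP; apply: measurable_prod => i _.
  by apply: (measurableT_comp (mk i)); exact: measurable_tnth.
have p0 m (k : 'I_m -> R -> R) (t : m.-tuple R) : (forall i y, (0 <= k i y)%R) ->
    0 <= (\prod_(i < m) k i (tnth t i))%:E.
  by move=> k0; rewrite lee_fin prodr_ge0.
rewrite integral_lebesgue_tupleS//; [|exact: mp|by move=> t; exact: p0].
rewrite big_ord_recl/= -(IH (fun i => h (lift ord0 i)))//.
have inner x : \int[lebesgue_tuple n]_t
      (\prod_(i < n.+1) h i (tnth (tcons (x, t)) i))%:E =
    (h ord0 x)%:E * \int[lebesgue_tuple n]_t
      (\prod_(i < n) h (lift ord0 i) (tnth t i))%:E.
  rewrite -ge0_integralZl_EFin//; last 2 first.
  - by move=> t _; exact: (p0 _ (fun i => h (lift ord0 i))).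
  - by apply: (mp _ (fun i => h (lift ord0 i))).
  apply: eq_integral => t _; rewrite big_ord_recl tnth0 EFinM.
  by under eq_bigr do rewrite tnthS.
under eq_integral do rewrite inner.
rewrite ge0_integralZr//.
- by apply/measurable_EFinP; exact: mh.
- by move=> x _; rewrite lee_fin.
- by apply: integral_ge0 => t _; exact: (p0 _ (fun i => h (lift ord0 i))).
Qed.

End lebesgue_tuple_integral.

(** * Integration over the coordinate subspaces R^S *)

Section slab_integral.
Context {R : realType}.
Local Open Scope ereal_scope.

(** The integrand lives on all of R^n, so that integrals over different supports can be compared
    without identifying tuple types of different lengths. *)
Definition slab_integral n (S : {set 'I_n}) (f : n.-tuple R -> \bar R) : \bar R :=
  \int[lebesgue_tuple #|S|]_t f (@extend0 R n S t).

(* [extend0] with the number of coordinates decoupled from [S], so that the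
   equality of cardinals in the recursion on n needs no cast. *)
Let ext n (s : seq 'I_n) k (t : k.-tuple R) : n.-tuple R :=
  [tuple nth 0%R t (index i s) | i < n].

Definition tail_set n (S : {set 'I_n.+1}) : {set 'I_n} :=
  [set i | lift ord0 i \in S]%SET.

Let enum_set_ordS n (S : {set 'I_n.+1}) : enum S =
  (if ord0 \in S then [:: ord0] else [::]) ++ map (lift ord0) (enum (tail_set S)).
Proof.
rewrite {1}/enum_mem -enumT enum_ordSl/= filter_map.
have -> : enum (tail_set S) = [seq i <- enum 'I_n | lift ord0 i \in S].
  by rewrite {1}/enum_mem -enumT; apply: seq.eq_filter => i; rewrite /= finset.inE.
by case: ifP.
Qed.

Let ext_cons n (s : seq 'I_n) k x (t : k.-tuple R) :
  ext (ord0 :: map (lift ord0) s) (tcons (x, t)) = tcons (x, ext s t).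
Proof.
apply: eq_from_tnth => i; rewrite tnth_mktuple.
have [j ->|->] := unliftP ord0 i; last by rewrite /= tnth0.
rewrite tnthS tnth_mktuple /=.
by rewrite index_map//; exact: lift_inj.
Qed.

Let ext_skip n (s : seq 'I_n) k (t : k.-tuple R) : k = size s ->
  ext (map (lift ord0) s) t = tcons (0%R, ext s t).
Proof.
move=> ks; apply: eq_from_tnth => i; rewrite tnth_mktuple.
have [j ->|->] := unliftP ord0 i.
  by rewrite tnthS tnth_mktuple index_map//; exact: lift_inj.
rewrite tnth0 nth_default// size_tuple ks -(size_map (lift ord0) s).
rewrite leqNgt index_mem; apply/mapP => -[j _ /eqP].
by rewrite (negbTE (neq_lift _ _)).
Qed.

Let slab_integralE n (S : {set 'I_n}) (f : n.-tuple R -> \bar R) k :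
  #|S| = k -> slab_integral S f = \int[lebesgue_tuple k]_t f (ext (enum S) t).
Proof. by move=> <-. Qed.

Lemma slab_integral_ge0 n (S : {set 'I_n}) f :
  (forall t, 0 <= f t) -> 0 <= slab_integral S f.
Proof. by move=> f0; exact: integral_ge0. Qed.

Lemma slab_integral_in n (S : {set 'I_n.+1}) f : ord0 \in S ->
  measurable_fun setT f -> (forall t, 0 <= f t) ->
  slab_integral S f = \int[lebesgue_measure]_x
    slab_integral (tail_set S) (fun t => f (tcons (x, t))).
Proof.
move=> S0 mf f0; have SE : enum S = ord0 :: map (lift ord0) (enum (tail_set S)).
  by rewrite enum_set_ordS S0.
rewrite (@slab_integralE _ S f #|tail_set S|.+1); last first.
  by rewrite cardE SE /= size_map -cardE.
rewrite SE integral_lebesgue_tupleS//; last first.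
  apply: (measurableT_comp mf); rewrite -SE.
  have <- : #|S| = #|tail_set S|.+1 by rewrite cardE SE /= size_map -cardE.
  exact: (@measurable_extend0 R _ S).
by apply: eq_integral => x _; apply: eq_integral => t _; rewrite ext_cons.
Qed.

Lemma slab_integral_out n (S : {set 'I_n.+1}) f : ord0 \notin S ->
  slab_integral S f = slab_integral (tail_set S) (fun t => f (tcons (0%R, t))).
Proof.
move=> S0; have SE : enum S = map (lift ord0) (enum (tail_set S)).
  by rewrite enum_set_ordS (negbTE S0).
rewrite (@slab_integralE _ S f #|tail_set S|); last first.
  by rewrite cardE SE /= size_map -cardE.
rewrite SE; apply: eq_integral => t _.
by rewrite ext_skip// -cardE.
Qed.

Lemma slab_integral_ord0 (S : {set 'I_0}) f :
  slab_integral S f = f [tuple].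
Proof.
rewrite (@slab_integralE _ S f 0); last by apply: eq_card0 => -[].
rewrite integral_lebesgue_tuple0; first by congr f; exact: tuple0.
rewrite (_ : (fun _ => _) = cst (f [tuple])) //.
by apply/funext => t; congr f; rewrite [LHS]tuple0.
Qed.

Lemma measurable_slab_integral n (S : {set 'I_n}) (f : n.+1.-tuple R -> \bar R) :
  measurable_fun setT f -> (forall t, 0 <= f t) ->
  measurable_fun setT (fun x => slab_integral S (fun t => f (tcons (x, t)))).
Proof.
move=> mf f0; apply: (measurable_fun_fubini_tonelli_F (m2 := lebesgue_tuple #|S|)
  (fun xt => f (tcons (xt.1, @extend0 R n S xt.2)))) => //.
apply: (measurableT_comp mf); apply: (measurableT_comp (@measurable_tcons R n)).
apply/measurable_fun_pair => //=.
by apply: (measurableT_comp (@measurable_extend0 R n S)).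
Qed.

Definition depends_on n (S : {set 'I_n}) T (f : n.-tuple R -> T) :=
  forall t u, {in S, tnth t =1 tnth u} -> f t = f u.

Let depends_on_tail n (S : {set 'I_n.+1}) T (f : _ -> T) x :
  depends_on S f -> depends_on (tail_set S) (fun t => f (tcons (x, t))).
Proof.
move=> fS t u tu; apply: fS => i; have [j ->|->] := unliftP ord0 i.
  by move=> jS; rewrite !tnthS; apply: tu; rewrite finset.inE.
by rewrite !tnth0.
Qed.

Let depends_on_out n (S : {set 'I_n.+1}) T (f : _ -> T) x t :
  depends_on S f -> ord0 \notin S -> f (tcons (x, t)) = f (tcons (0%R, t)).
Proof.
move=> fS S0; apply: fS => i iS; have [j ij|ij] := unliftP ord0 i.
  by rewrite ij !tnthS.
by move: iS; rewrite ij (negbTE S0).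
Qed.

(** Tonelli on the product of R^S1 and R^S2. The increasing enumeration of the union interleaves the
    two sets, so the proof is by induction on n, integrating out coordinate 0 according to the set
    that contains it. *)
Lemma slab_integralM n (S1 S2 : {set 'I_n}) (f1 f2 : n.-tuple R -> \bar R) :
  (S1 \subset ~: S2)%SET -> measurable_fun setT f1 -> measurable_fun setT f2 ->
  (forall t, 0 <= f1 t) -> (forall t, 0 <= f2 t) ->
  depends_on S1 f1 -> depends_on S2 f2 ->
  slab_integral (S1 :|: S2)%SET (fun t => f1 t * f2 t) =
  slab_integral S1 f1 * slab_integral S2 f2.
Proof.
elim: n S1 S2 f1 f2 => [|n IH] S1 S2 f1 f2 S12 mf1 mf2 f10 f20 fS1 fS2.
  by rewrite !slab_integral_ord0.
have tailU : tail_set (S1 :|: S2)%SET = (tail_set S1 :|: tail_set S2)%SET.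
  by apply/finset.setP => i; rewrite !finset.inE.
have tail12 : (tail_set S1 \subset ~: tail_set S2)%SET.
  apply/fintype.subsetP => i; rewrite !finset.inE => /(fintype.subsetP S12).
  by rewrite finset.inE.
have IHx x : slab_integral (tail_set (S1 :|: S2)%SET)
    (fun t => f1 (tcons (x, t)) * f2 (tcons (x, t))) =
    slab_integral (tail_set S1) (fun t => f1 (tcons (x, t))) *
    slab_integral (tail_set S2) (fun t => f2 (tcons (x, t))).
  rewrite tailU; apply: IH => //.
  - exact: measurable_tcons_section.
  - exact: measurable_tcons_section.
  - exact: depends_on_tail.
  - exact: depends_on_tail.
have m12 : measurable_fun setT (fun t => f1 t * f2 t) by exact: emeasurable_funM.
have f120 t : 0 <= f1 t * f2 t by exact: mule_ge0.
(* If coordinate 0 lies in one set it is outside the other; the function attached to the other set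
   is constant in it, and its integral comes out as a factor. *)
have [S10|S10] := boolP (ord0 \in S1).
  have S20 : ord0 \notin S2.
    by move/fintype.subsetP : S12 => /(_ _ S10); rewrite finset.inE.
  rewrite slab_integral_in//; last by rewrite finset.inE S10.
  rewrite (slab_integral_in S10)// (slab_integral_out f2 S20).
  under eq_integral => x _.
    rewrite IHx.
    rewrite [X in _ * X](_ : _ =
        slab_integral (tail_set S2) (fun t => f2 (tcons (0%R, t)))); last first.
      by apply: eq_integral => t _; exact: (depends_on_out x _ fS2).
    over.
  rewrite ge0_integralZr//.
  - exact: measurable_slab_integral.
  - by move=> x _; exact: slab_integral_ge0.
  - exact: slab_integral_ge0.
have [S20|S20] := boolP (ord0 \in S2).
  rewrite slab_integral_in//; last by rewrite finset.inE S20 orbT.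
  rewrite (slab_integral_in S20)// (slab_integral_out f1 S10).
  under eq_integral => x _.
    rewrite IHx.
    rewrite [X in X * _](_ : _ =
        slab_integral (tail_set S1) (fun t => f1 (tcons (0%R, t)))); last first.
      by apply: eq_integral => t _; exact: (depends_on_out x _ fS1).
    over.
  rewrite ge0_integralZl//.
  - exact: measurable_slab_integral.
  - by move=> x _; exact: slab_integral_ge0.
  - exact: slab_integral_ge0.
rewrite slab_integral_out; last by rewrite finset.inE negb_or S10.
by rewrite IHx -!slab_integral_out.
Qed.

End slab_integral.

(** * One-dimensional Gaussian integrals *)

Section gaussian_integrals.
Context {R : realType}.

Lemma measurable_expR_quadratic (a b c : R) :
  measurable_fun setT (fun y : R => expR (c * (y - b) - a * (y - b) ^+ 2)).
Proof.
apply: measurableT_comp => //; apply: measurable_funB.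
  by apply: measurable_funM => //; exact: measurable_funB.
by apply: measurable_funM => //; apply: measurable_funX; exact: measurable_funB.
Qed.

(** This is the normalisation of the normal density with variance [1 / (2 a)]. *)
Lemma integral_expR_square (a b : R) : 0 < a ->
  (\int[lebesgue_measure]_y (expR (- a * (y - b) ^+ 2))%:E =
   (Num.sqrt (pi / a))%:E)%E.
Proof.
move=> a0; pose s := Num.sqrt ((2 * a)^-1).
have s2 : s ^+ 2 = (2 * a)^-1 by rewrite sqr_sqrtr// invr_ge0 mulr_ge0// ltW.
have s0 : s != 0 by rewrite gt_eqF// sqrtr_gt0 invr_gt0 mulr_gt0.
have := integral_normal_pdf b s; rewrite normal_pdfE//.
under eq_integral => y _ do rewrite EFinM.
rewrite ge0_integralZl_EFin ?normal_peak_ge0//; last 2 first.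
- by move=> y _; rewrite lee_fin normal_fun_ge0.
- by apply/measurable_EFinP; exact: measurable_normal_fun.
have -> : (\int[lebesgue_measure]_y (normal_fun b s y)%:E =
    \int[lebesgue_measure]_y (expR (- a * (y - b) ^+ 2))%:E)%E.
  apply: eq_integral => y _; rewrite /normal_fun s2; congr (expR _)%:E.
  by rewrite -mulr_natr; field; rewrite gt_eqF.
have p0 := normal_peak_gt0 s0.
have Ps : Num.sqrt (pi / a) = (normal_peak s)^-1.
  by rewrite /normal_peak invrK s2; congr Num.sqrt; rewrite -mulr_natr; field; rewrite gt_eqF.
move=> I1; rewrite Ps.
have : (((normal_peak s)^-1)%:E * ((normal_peak s)%:E *
    \int[lebesgue_measure]_y (expR (- a * (y - b) ^+ 2))%:E) =
    ((normal_peak s)^-1)%:E * 1)%E by rewrite I1.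
by rewrite muleA -EFinM mulVf ?gt_eqF// mul1e mule1.
Qed.

(** Completing the square recentres the Gaussian and multiplies it by [exp (c^2 / (4 a))], which is
    at least 1: the linear term can only increase the integral. *)
Lemma ge_integral_expR_quadratic (a b c : R) : 0 < a ->
  ((Num.sqrt (pi / a))%:E <=
   \int[lebesgue_measure]_y (expR (c * (y - b) - a * (y - b) ^+ 2))%:E)%E.
Proof.
move=> a0; rewrite -(integral_expR_square (b + c / (2 * a)) a0).
apply: le_ge0_integral => y; rewrite lee_fin ?expR_ge0// ler_expR.
have -> : c * (y - b) - a * (y - b) ^+ 2 =
    c ^+ 2 / (4 * a) + - a * (y - (b + c / (2 * a))) ^+ 2.
  by field; rewrite gt_eqF.
by rewrite lerDr divr_ge0 ?sqr_ge0// mulr_ge0// ltW.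
Qed.

End gaussian_integrals.

(** * Coordinates of vectors extended by zero *)

Section slab_coordinates.
Context {R : realType}.

Lemma tnth_extend0 n (S : {set 'I_n}) (t : #|S|.-tuple R) k :
  tnth (extend0 t) (enum_val k) = tnth t k.
Proof.
rewrite tnth_mktuple (tnth_nth 0); congr (nth 0 t _).
by rewrite (enum_val_nth (enum_val k)) index_uniq ?enum_uniq// -cardE.
Qed.

Lemma tnth_extend0_out n (S : {set 'I_n}) (t : #|S|.-tuple R) i :
  i \notin S -> tnth (extend0 t) i = 0.
Proof.
move=> iS; rewrite tnth_mktuple nth_default// size_tuple cardE.
by rewrite leqNgt index_mem mem_enum.
Qed.

Lemma extend0K n (S : {set 'I_n}) (t : #|S|.-tuple R) :
  coord_proj S (extend0 t) = t.
Proof. by apply: eq_from_tnth => k; rewrite tnth_mktuple tnth_extend0. Qed.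

Lemma measurable_coord_proj n (S : {set 'I_n}) :
  measurable_fun setT (@coord_proj R n S).
Proof.
apply/measurable_fun_tnthP => i.
rewrite (_ : _ \o _ = @tnth n R ^~ (enum_val i)); first exact: measurable_tnth.
by apply/funext => t /=; rewrite tnth_mktuple.
Qed.

Lemma enorm_coord_proj n (S : {set 'I_n}) (t : n.-tuple R) :
  enorm (coord_proj S t) ^+ 2 = \sum_(i in S) tnth t i ^+ 2.
Proof.
rewrite sqr_sqrtr; last by apply: sumr_ge0 => i _; exact: sqr_ge0.
by rewrite [RHS]big_enum_val; apply: eq_bigr => i _; rewrite tnth_mktuple.
Qed.

Lemma slab_integral_prod n (S : {set 'I_n}) (h : 'I_n -> R -> R) :
  (forall i, measurable_fun setT (h i)) -> (forall i y, 0 <= h i y) ->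
  slab_integral S (fun t => (\prod_(i in S) h i (tnth t i))%:E) =
  (\prod_(i in S) \int[lebesgue_measure]_y (h i y)%:E)%E.
Proof.
move=> mh h0; rewrite /slab_integral.
under eq_integral => t _.
  rewrite big_enum_val/=; under eq_bigr do rewrite tnth_extend0.
  over.
rewrite (integral_lebesgue_tuple_prod (h := fun k => h (enum_val k)))//.
by rewrite [RHS]big_enum_val.
Qed.

End slab_coordinates.

(** * The normal likelihood on R^n *)

Section normal_tuple_facts.
Context {R : realType} (n : nat).
Implicit Types theta x : n.-tuple R.

Lemma normal_tuple_pdfE theta x : normal_tuple_pdf theta x =
  normal_peak 1 ^+ n * expR (- (\sum_(i < n) (tnth x i - tnth theta i) ^+ 2) / 2).
Proof.
rewrite /normal_tuple_pdf.
under eq_bigr => i _ do rewrite normal_pdfE ?oner_neq0//.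
rewrite big_split/= prodr_const card_ord; congr (_ * _).
rewrite -expR_sum; congr expR.
by rewrite -sumrN mulr_suml; apply: eq_bigr => i _; rewrite expr1n.
Qed.

Lemma normal_tuple_pdf_gt0 theta x : 0 < normal_tuple_pdf theta x.
Proof. by rewrite normal_tuple_pdfE mulr_gt0 ?expR_gt0// exprn_gt0// normal_peak_gt0. Qed.

(** Each factor is at most [1 / sqrt (2 pi)]. This bound keeps the integrals in the posterior
    finite, so that [fine] loses nothing there. *)
Lemma normal_tuple_pdf_le1 theta x : normal_tuple_pdf theta x <= 1.
Proof.
apply: numdomain.Num.Theory.prodr_ile1 => i _; rewrite normal_pdf_ge0/=.
rewrite (le_trans (normal_pdf_ub _ _ (oner_neq0 R)))// /normal_peak invf_le1; last first.
  by rewrite sqrtr_gt0 expr1n mul1r pmulrn_rgt0// pi_gt0.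
rewrite -[leLHS]sqrtr1 ler_sqrt ?expr1n ?mul1r.
  by rewrite -mulr_natr; have := pi_ge2 R; lra.
by rewrite -mulr_natr; have := pi_ge2 R; lra.
Qed.

Lemma measurable_normal_tuple_pdf2 d (T : measurableType d)
    (theta x : T -> n.-tuple R) :
  measurable_fun setT theta -> measurable_fun setT x ->
  measurable_fun setT (fun t => normal_tuple_pdf (theta t) (x t)).
Proof.
move=> mtheta mx; under eq_fun do rewrite normal_tuple_pdfE.
apply: measurable_funM => //; apply: measurableT_comp => //.
apply: measurable_funM => //; apply: measurableT_comp => //.
apply: measurable_sum => i; apply: measurable_funX.
by apply: measurable_funB; apply: (measurableT_comp (measurable_tnth i)).
Qed.

(** Only the majorant [F] has to be measurable, so the lemma applies to the posterior probability of
    a set. *)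
Lemma expectation_normal_tuple_le theta (f : n.-tuple R -> R)
    (F : n.-tuple R -> \bar R) :
  (forall x, 0 <= f x) -> (forall x, ((f x)%:E <= F x)%E) ->
  measurable_fun setT F ->
  ('E_(normal_tuple theta)[f] <=
   \int[lebesgue_tuple n]_x (F x * (normal_tuple_pdf theta x)%:E))%E.
Proof.
move=> f0 fF mF; have F0 x : (0 <= F x)%E by rewrite (le_trans _ (fF x))// lee_fin.
rewrite unlock.
apply: le_trans (le_ge0_integral (normal_tuple theta) _ fF) _ => //.
rewrite (@ge0_integral_mixture _ _ _ (normal_tuple theta) unit (fun=> n) (fun=> 1)
  (fun=> id) (fun=> normal_tuple_pdf theta))//.
- by rewrite (big_pred1 tt)/= ?mul1e// => -[].
- by move=> _; exact: measurable_normal_tuple_pdf.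
- by move=> _ x; exact: normal_tuple_pdf_ge0.
- by move=> A mA; rewrite (big_pred1 tt)/= ?mul1e ?preimage_id// => -[].
Qed.

End normal_tuple_facts.

(** * The posterior as a ratio of sums over supports *)

Section posterior_facts.
Context {R : realType} (n : nat).
Variables (w : dim_prior R n) (g : forall k, prob_density R k).
Local Open Scope ereal_scope.

Definition set_weight (S : {set 'I_n}) : R := (w #|S| / 'C(n, #|S|)%:R)%R.

Lemma set_weight_gt0 S : (0 < set_weight S)%R.
Proof.
have Sn : (#|S| <= n)%N by rewrite -[leqRHS]card_ord max_card.
by rewrite divr_gt0 ?dim_prior_gt0// ltr0n bin_gt0.
Qed.

(** Viewed on R^n, slab densities of different supports can be evaluated at the same point. *)
Definition slab_density (S : {set 'I_n}) (theta : n.-tuple R) : R :=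
  g #|S| (coord_proj S theta).

Lemma slab_density_ge0 S theta : (0 <= slab_density S theta)%R.
Proof. exact: prob_density_ge0. Qed.

Lemma measurable_slab_density S : measurable_fun setT (slab_density S).
Proof.
have -> : slab_density S = g #|S| \o coord_proj S by [].
apply: measurableT_comp; first exact: measurable_prob_density.
exact: measurable_coord_proj.
Qed.

Lemma slab_integral_density S :
  slab_integral S (fun theta => (slab_density S theta)%:E) = 1.
Proof.
rewrite -(integral_prob_density (g #|S|)); apply: eq_integral => t _.
by rewrite /slab_density extend0K.
Qed.

Lemma integral_prior (h : n.-tuple R -> \bar R) :
  measurable_fun setT h -> (forall t, 0 <= h t) ->
  \int[prior w g]_t h t = \sum_S (set_weight S)%:E *
    slab_integral S (fun theta => h theta * (slab_density S theta)%:E).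
Proof.
move=> mh h0.
rewrite (@ge0_integral_mixture _ _ _ (prior w g) _ (fun S : {set 'I_n} => #|S|)
  set_weight (fun S => @extend0 R n S) (fun S => g #|S|))//.
- apply: eq_bigr => S _; congr (_ * _); apply: eq_integral => t _.
  by rewrite /slab_density extend0K.
- by move=> S; exact/ltW/set_weight_gt0.
- by move=> S; exact: measurable_extend0.
- by move=> S; exact: measurable_prob_density.
- by move=> S t; exact: prob_density_ge0.
Qed.

Let int1 : \int[prior w g]_t (cst 1) t = 1.
Proof. by rewrite integral_cst//= probability_setT mule1. Qed.

(** The prior is a probability measure; integrating the constant 1 against it leaves the sum of the
    weights, since each slab has mass 1. *)
Lemma sum_set_weight : (\sum_S set_weight S = 1)%R.
Proof.
apply: EFin_inj; rewrite -int1 integral_prior// -sumEFin; apply: eq_bigr => S _.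
rewrite (_ : slab_integral _ _ = 1) ?mule1// -[RHS](slab_integral_density S).
by apply: eq_integral => t _; rewrite /= mul1e.
Qed.

Definition evidence (x : n.-tuple R) : \bar R := \sum_S (set_weight S)%:E *
  slab_integral S (fun theta =>
    (normal_tuple_pdf theta x * slab_density S theta)%:E).

Let int_pdf_le1 x B : \int[prior w g]_(t in B) (normal_tuple_pdf t x)%:E <= 1.
Proof.
rewrite -[leRHS]int1 integral_mkcond.
apply: le_ge0_integral => t; rewrite /patch; case: ifP => // _.
- by rewrite lee_fin normal_tuple_pdf_ge0.
- by rewrite lee_fin normal_tuple_pdf_le1.
Qed.

Let int_pdf_ge0 x B : 0 <= \int[prior w g]_(t in B) (normal_tuple_pdf t x)%:E.
Proof. by apply: integral_ge0 => t _; rewrite lee_fin normal_tuple_pdf_ge0. Qed.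

Let int_pdf_fin x B :
  \int[prior w g]_(t in B) (normal_tuple_pdf t x)%:E \is a fin_num.
Proof. by rewrite ge0_fin_numE// (le_lt_trans (int_pdf_le1 _ _))// ltry. Qed.

Lemma posterior_ge0 x B : (0 <= posterior w g x B)%R.
Proof. by rewrite divr_ge0// fine_ge0. Qed.

Lemma posterior_le x B (c : R) : (0 <= c)%R -> measurable B ->
  \sum_S (set_weight S)%:E * slab_integral S (fun theta =>
    (normal_tuple_pdf theta x * slab_density S theta * \1_B theta)%:E) <=
  c%:E * evidence x -> (posterior w g x B <= c)%R.
Proof.
move=> c0 mB H; rewrite /posterior /Rintegral.
set N := \int[_]_(_ in B) _; set D := \int[_]_(_ in _) _.
have mpdf : measurable_fun setT (fun t => (normal_tuple_pdf t x)%:E).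
  by apply/measurable_EFinP; exact: measurable_normal_tuple_pdf2.
have DE : D = evidence x.
  rewrite /D integral_prior//; first by move=> t; rewrite lee_fin normal_tuple_pdf_ge0.
have NE : N = \sum_S (set_weight S)%:E * slab_integral S (fun theta =>
    (normal_tuple_pdf theta x * slab_density S theta * \1_B theta)%:E).
  rewrite /N integral_mkcond epatch_indic integral_prior.
  - apply: eq_bigr => S _; congr (_ * _); apply: eq_integral => t _.
    by rewrite -!EFinM mulrAC.
  - by apply: emeasurable_funM => //; exact/measurable_EFinP.
  - by move=> t; rewrite -EFinM lee_fin mulr_ge0// normal_tuple_pdf_ge0.
have ND : N <= c%:E * D by rewrite NE DE.
(* A zero denominator makes the posterior 0, since the inverse of 0 is 0. *)
have [D0|D0] := eqVneq (fine D) 0%R; first by rewrite D0 invr0 mulr0.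
rewrite ler_pdivrMr; last by rewrite lt_neqAle eq_sym D0 fine_ge0//; exact: int_pdf_ge0.
rewrite -lee_fin EFinM fineK; last exact: int_pdf_fin.
by rewrite fineK//; exact: int_pdf_fin.
Qed.

Lemma posterior_le1 x B : (posterior w g x B <= 1)%R.
Proof.
rewrite /posterior /Rintegral.
set N := \int[_]_(_ in B) _; set D := \int[_]_(_ in _) _.
have ND : N <= D.
  rewrite /N integral_mkcond; apply: le_ge0_integral => t; rewrite /patch.
    by case: ifP => // _; rewrite lee_fin normal_tuple_pdf_ge0.
  by case: ifP => // _; rewrite lee_fin normal_tuple_pdf_ge0.
have D0 : (0 <= fine D)%R by rewrite fine_ge0//; exact: int_pdf_ge0.
move: D0; rewrite le_eqVlt => /orP[/eqP <-|D0]; first by rewrite invr0 mulr0.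
rewrite ler_pdivrMr// mul1r; apply: fine_le => //; exact: int_pdf_fin.
Qed.

End posterior_facts.

(** * Binomial estimates and prior weights of supports *)

Section dimension_weights.
Context {R : realType}.

(** Both sides count the pairs of disjoint sets of sizes a and b: choose one after the other, or
    first their union. *)
Lemma bin_split n a b : (a + b <= n)%N ->
  ('C(n, a) * 'C(n - a, b) = 'C(n, a + b) * 'C(a + b, b))%N.
Proof.
move=> abn; have bna : (b <= n - a)%N by rewrite leq_subRL ?(leq_trans (leq_addr _ _) abn).
apply/eqP; rewrite -(eqn_pmul2r (fact_gt0 a)) -(eqn_pmul2r (fact_gt0 b)).
rewrite -(eqn_pmul2r (fact_gt0 (n - (a + b)))); apply/eqP.
transitivity (n`!).
  rewrite -(bin_fact (leq_trans (leq_addr b a) abn)) -(bin_fact bna) subnDA; ring.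
by rewrite -(bin_fact abn) -(bin_fact (leq_addl a b)) addnK; ring.
Qed.

(** The left side times [delta ^ a] is one term of the expansion of [(1 + delta) ^ (a + s)]. The
    growth rate in [s] can thus be brought as close to 1 as desired, at a price exponential in [a]
    only. *)
Lemma bin_exp_le (delta : R) (a s : nat) : 0 < delta ->
  ('C(a + s, s))%:R <= (1 + delta) ^+ s * (1 + delta^-1) ^+ a.
Proof.
move=> d0; have -> : 1 + delta^-1 = (1 + delta) / delta by field; rewrite gt_eqF.
rewrite expr_div_n mulrA -exprD ler_pdivlMr ?exprn_gt0// [(s + a)%N]addnC.
have -> : 'C(a + s, s) = 'C(a + s, a) by rewrite -[in RHS]bin_sub ?leq_addr// addKn.
rewrite [1 + delta]addrC exprD1n.
have alt : (a < (a + s).+1)%N by rewrite ltnS leq_addr.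
rewrite (bigD1 (Ordinal alt))//= mulr_natl lerDl sumr_ge0// => i _.
by rewrite mulrn_wge0// exprn_ge0// ltW.
Qed.

Lemma sum_expr_le (rho : R) L N : 0 < rho < 1 ->
  \sum_(s < N | (L <= s)%N) rho ^+ s <= rho ^+ L / (1 - rho).
Proof.
move=> /andP[r0 r1].
rewrite -(big_mkord (fun s => (L <= s)%N) (fun s => rho ^+ s)).
have [NL|LN] := leqP N L.
  rewrite big_nat_cond big_pred0 ?divr_ge0 ?exprn_ge0 ?subr_ge0 ?ltW//.
  move=> i; apply/negbTE/negP => /andP[/andP[_ iN] Li].
  by have := leq_trans iN (leq_trans NL Li); rewrite ltnn.
rewrite (big_cat_nat (leq0n L) (ltnW LN))/=.
rewrite big_nat_cond big_pred0 ?add0r; last first.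
  by move=> i; apply/negbTE/negP => /andP[/andP[_ iL]]; rewrite leqNgt iL.
rewrite (@le_trans _ _ (\sum_(L <= s < L + (N - L)) rho ^+ s))//.
  rewrite subnKC; last exact: ltnW.
  by rewrite big_mkcond ler_sum// => i _; case: ifP => // _; rewrite exprn_ge0// ltW.
rewrite geometric_partial_tail; apply: geometric_le_lim => //.
  by rewrite exprn_ge0// ltW.
by rewrite gtr0_norm.
Qed.

Lemma sum_subsets_card n (T : {set 'I_n}) (f : nat -> R) L :
  \sum_(S : {set 'I_n} | (S \subset T) && (L <= #|S|)%N) f #|S| =
  \sum_(s < #|T|.+1 | (L <= s)%N) 'C(#|T|, s)%:R * f s.
Proof.
have Slt (S : {set 'I_n}) : S \subset T -> (#|S| < #|T|.+1)%N.
  by move=> ST; rewrite ltnS subset_leq_card.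
rewrite (partition_big (fun S : {set 'I_n} => inord #|S| : 'I_#|T|.+1)
  (fun s => (L <= s)%N))/=; last first.
  by move=> S /andP[ST LS]; rewrite inordK// Slt.
apply: eq_bigr => s Ls.
rewrite (eq_bigl (mem [set S : {set 'I_n} | S \subset T & #|S| == s]%SET)).
  rewrite (eq_bigr (fun=> f s)); last first.
    by move=> S /=; rewrite !finset.inE => /andP[_ /eqP ->].
  by rewrite sumr_const cards_draws mulr_natl.
move=> S; rewrite /= finset.inE; have [ST|//] := boolP (S \subset T).
rewrite -val_eqE /= inordK; last exact: Slt.
by case: eqVneq => [->|]; rewrite ?Ls ?andbF ?andbT.
Qed.

Variables (n : nat) (w : dim_prior R n) (D : R).
Hypothesis D0 : 0 < D.
Hypothesis wD : forall k, (1 <= k <= n)%N -> w k <= D * w k.-1.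

Lemma dim_prior_decrease a b : (a + b <= n)%N -> w (a + b)%N <= D ^+ b * w a.
Proof.
elim: b => [|b IH] abn; first by rewrite addn0 expr0 mul1r.
move: abn; rewrite addnS => abn; apply: le_trans (wD _) _; first by rewrite abn.
by rewrite exprS -mulrA /= ler_pM2l// IH// ltnW.
Qed.

Variables (m1 Cst delta : R) (s0 : nat).
Hypothesis m10 : 0 < m1.
Hypothesis C0 : 0 < Cst.
Hypothesis delta0 : 0 < delta.

(** Bounds the cost of adding [b] coordinates off the true support, of size [s0], to any subset of
    it. The factor [max 1 m1 ^ s0] absorbs [m1 ^ a] for every [a <= s0], which makes the bound
    independent of the subset. *)
Definition union_weight (b : nat) : R :=
  Cst * Num.max 1 m1 ^+ s0 * (D * m1) ^+ b * ('C(s0 + b, b)%:R / 'C(n - s0, b)%:R).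

Lemma union_weight_ge0 b : 0 <= union_weight b.
Proof.
have mu0 : 0 <= Num.max 1 m1 by rewrite le_max ler01.
by rewrite /union_weight !mulr_ge0 ?exprn_ge0 ?mulr_ge0 ?invr_ge0// ltW.
Qed.

(** Strict exponential decrease gives [D ^ b], and [bin_split] rewrites the ratio of the two uniform
    weights as ['C(a + b, b) / 'C(n - a, b)], which increases with [a] and is taken at [a = s0]. *)
Lemma set_weight_union (S S1 : {set 'I_n}) b :
  (#|S1| <= s0)%N -> (s0 + b <= n)%N -> #|S| = (#|S1| + b)%N ->
  set_weight w S * (Cst * m1 ^+ (#|S1| + b)) <= union_weight b * set_weight w S1.
Proof.
set a := #|S1| => as0 s0bn Sab; rewrite /set_weight Sab -/a.
have abn : (a + b <= n)%N by rewrite (leq_trans _ s0bn)// leq_add2r.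
have wa0 : 0 <= w a by rewrite ltW// dim_prior_gt0// (leq_trans (leq_addr b a) abn).
have bpos k j : (j <= k)%N -> 0 < ('C(k, j))%:R :> R by move=> ?; rewrite ltr0n bin_gt0.
have an := leq_trans (leq_addr b a) abn.
have bna : (b <= n - a)%N by rewrite leq_subRL.
have s0n : (s0 <= n)%N by rewrite (leq_trans (leq_addr b s0)).
have bns : (b <= n - s0)%N by rewrite leq_subRL.
have inv_bin : ('C(n, a + b)%:R)^-1 =
    'C(a + b, b)%:R / 'C(n - a, b)%:R / 'C(n, a)%:R :> R.
  have := congr1 (fun k => k%:R : R) (bin_split abn); rewrite !natrM => E.
  have Cab : 'C(a + b, b)%:R = 'C(n, a)%:R * 'C(n - a, b)%:R / 'C(n, a + b)%:R :> R.
    by rewrite E mulrAC divff ?mul1r// gt_eqF// bpos.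
  rewrite Cab; field.
  by rewrite !gt_eqF ?bpos.
rewrite inv_bin.
have mle : m1 ^+ (a + b) <= Num.max 1 m1 ^+ s0 * m1 ^+ b.
  rewrite exprD ler_pM2r ?exprn_gt0//.
  rewrite (@le_trans _ _ (Num.max 1 m1 ^+ a))//.
    by rewrite lerXn2r ?nnegrE ?le_max ?lexx ?orbT ?ltW.
  by rewrite ler_weXn2l// le_max lexx.
have dwn := dim_prior_decrease abn.
have Cle : 'C(a + b, b)%:R / 'C(n - a, b)%:R <=
    'C(s0 + b, b)%:R / 'C(n - s0, b)%:R :> R.
  apply: ler_pM => //; rewrite ?invr_ge0// ?ler_nat ?leq_bin2l ?leq_add2r//.
  by rewrite lef_pV2 ?posrE ?bpos// ler_nat leq_bin2l// leq_sub2l.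
rewrite /union_weight exprMn.
have -> : Cst * Num.max 1 m1 ^+ s0 * (D ^+ b * m1 ^+ b) *
    ('C(s0 + b, b)%:R / 'C(n - s0, b)%:R) * (w a / 'C(n, a)%:R) =
    (D ^+ b * w a) * (('C(s0 + b, b)%:R / 'C(n - s0, b)%:R) / 'C(n, a)%:R) *
    (Cst * (Num.max 1 m1 ^+ s0 * m1 ^+ b)) by ring.
apply: ler_pM.
- by rewrite mulr_ge0 ?divr_ge0// ltW// dim_prior_gt0.
- by rewrite mulr_ge0 ?exprn_ge0// ltW.
- apply: ler_pM => //; first by rewrite ltW// dim_prior_gt0.
  by rewrite ler_pM2r ?invr_gt0 ?bpos.
- by rewrite ler_pM2l.
Qed.

(** The number of subsets of size [s] cancels ['C(n - s0, s)]; by [bin_exp_le] the remaining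
    ['C(s0 + s, s)] only changes the ratio [D * m1] into [D * m1 * (1 + delta)], leaving a geometric
    tail. *)
Lemma sum_union_weight (T : {set 'I_n}) L : #|T| = (n - s0)%N ->
  D * m1 * (1 + delta) < 1 ->
  \sum_(S : {set 'I_n} | (S \subset T) && (L <= #|S|)%N) union_weight #|S| <=
  Cst / (1 - D * m1 * (1 + delta)) * (Num.max 1 m1 * (1 + delta^-1)) ^+ s0 *
  (D * m1 * (1 + delta)) ^+ L.
Proof.
move=> Tn rho1; rewrite sum_subsets_card Tn; set rho := D * m1 * (1 + delta).
have rho0 : 0 < rho by rewrite !mulr_gt0// addr_gt0.
have mu0 : 0 < Num.max 1 m1 by rewrite lt_max ltr01.
have K0 : 0 < Cst * Num.max 1 m1 ^+ s0 by rewrite mulr_gt0// exprn_gt0.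
rewrite (@le_trans _ _ (\sum_(s < (n - s0).+1 | (L <= s)%N)
    Cst * (Num.max 1 m1 * (1 + delta^-1)) ^+ s0 * rho ^+ s))//.
  apply: ler_sum => s _; rewrite /union_weight.
  have Cs : 0 < ('C(n - s0, s))%:R :> R by rewrite ltr0n bin_gt0 -ltnS.
  have -> : 'C(n - s0, s)%:R * (Cst * Num.max 1 m1 ^+ s0 * (D * m1) ^+ s *
      ('C(s0 + s, s)%:R / 'C(n - s0, s)%:R)) =
      Cst * Num.max 1 m1 ^+ s0 * (D * m1) ^+ s * 'C(s0 + s, s)%:R.
    by field; rewrite gt_eqF.
  have -> : (Num.max 1 m1 * (1 + delta^-1)) ^+ s0 =
      Num.max 1 m1 ^+ s0 * (1 + delta^-1) ^+ s0 by rewrite exprMn.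
  have -> : rho ^+ s = (D * m1) ^+ s * (1 + delta) ^+ s by rewrite -exprMn.
  have -> : Cst * (Num.max 1 m1 ^+ s0 * (1 + delta^-1) ^+ s0) *
      ((D * m1) ^+ s * (1 + delta) ^+ s) = Cst * Num.max 1 m1 ^+ s0 * (D * m1) ^+ s *
      ((1 + delta) ^+ s * (1 + delta^-1) ^+ s0) by ring.
  rewrite ler_pM2l ?bin_exp_le// mulr_gt0// exprn_gt0// mulr_gt0//.
rewrite -mulr_sumr.
have -> : Cst / (1 - rho) * (Num.max 1 m1 * (1 + delta^-1)) ^+ s0 * rho ^+ L =
  Cst * (Num.max 1 m1 * (1 + delta^-1)) ^+ s0 * (rho ^+ L / (1 - rho)) by ring.
rewrite ler_pM2l ?sum_expr_le ?rho0//.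
by rewrite mulr_gt0// exprn_gt0// mulr_gt0// addr_gt0// invr_gt0.
Qed.

End dimension_weights.

(** * Masking and shifting of vectors, and exchange of likelihood factors *)

Section masks.
Context {R : realType} (n : nat).
Implicit Types (S : {set 'I_n}) (t u x : n.-tuple R).

Definition tmask S t : n.-tuple R := [tuple if i \in S then tnth t i else 0 | i < n].

Definition tadd t u : n.-tuple R := [tuple tnth t i + tnth u i | i < n].

Lemma measurable_tmask S : measurable_fun setT (tmask S).
Proof.
apply/measurable_fun_tnthP => i.
rewrite (_ : _ \o _ = fun t => if i \in S then tnth t i else 0).
  by case: (i \in S); [exact: measurable_tnth|exact: measurable_cst].
by apply/funext => t /=; rewrite tnth_mktuple.
Qed.

Lemma measurable_tadd t : measurable_fun setT (tadd t).
Proof.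
apply/measurable_fun_tnthP => i.
rewrite (_ : _ \o _ = fun u => tnth t i + tnth u i).
  by apply: measurable_funD => //; exact: measurable_tnth.
by apply/funext => u /=; rewrite tnth_mktuple.
Qed.

Lemma measurable_normal_tuple_pdfV t :
  measurable_fun setT (fun x => (normal_tuple_pdf t x)^-1).
Proof.
under eq_fun do rewrite normal_tuple_pdfE invfM -expRN.
apply: measurable_funM => //; apply: measurableT_comp => //.
apply: measurableT_comp => //; apply: measurable_funM => //.
apply: measurableT_comp => //.
apply: measurable_sum => i; apply: measurable_funX.
by apply: measurable_funB => //; exact: measurable_tnth.
Qed.

Lemma measurable_supp_gt K : measurable [set t : n.-tuple R | (K < #|supp t|)%N].
Proof.
have cardE (t : n.-tuple R) :
    #|supp t|%:R = \sum_(i < n) (\1_(~` [set 0]) (tnth t i) : R).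
  rewrite -sum1_card natr_sum big_mkcond; apply: eq_bigr => i _.
  rewrite finset.inE indicE; have [ti|ti] := eqVneq (tnth t i) 0.
    by rewrite memNset//= ti => /(_ erefl).
  by rewrite mem_set//=; exact/eqP.
have -> : [set t : n.-tuple R | (K < #|supp t|)%N] =
    (fun t : n.-tuple R => \sum_(i < n) (\1_(~` [set 0]) (tnth t i) : R)) @^-1` `]K%:R, +oo[.
  by apply/seteqP; split => t /=; rewrite in_itv/= andbT -cardE ltr_nat.
rewrite -[X in measurable X]setTI.
have : measurable_fun setT
    (fun t : n.-tuple R => \sum_(i < n) (\1_(~` [set 0]) (tnth t i) : R)).
  apply: measurable_sum => i.
  apply: (measurableT_comp (f := \1_(~` [set 0 : R]) : R -> R)).
    by apply: measurable_indic; exact: measurableC.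
  exact: measurable_tnth.
by apply.
Qed.

Lemma tmask_extend0 S (t : #|S|.-tuple R) : tmask S (extend0 t) = extend0 t.
Proof.
apply: eq_from_tnth => i; rewrite tnth_mktuple.
by case: ifPn => // iS; rewrite tnth_extend0_out.
Qed.

Lemma depends_on_coord_proj S : depends_on S (@coord_proj R n S).
Proof.
move=> t u tu; apply: eq_from_tnth => k; rewrite !tnth_mktuple.
exact: tu (enum_valP k).
Qed.

Lemma depends_on_tmask S : depends_on S (tmask S).
Proof.
by move=> t u tu; apply: eq_from_tnth => i; rewrite !tnth_mktuple; case: ifP => // /tu.
Qed.

Lemma supp_extend0 S (t : #|S|.-tuple R) : supp (extend0 t) \subset S.
Proof.
apply/fintype.subsetP => i; rewrite finset.inE; apply: contraNT => iS.
by rewrite tnth_extend0_out.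
Qed.

(* The coordinates of [t] outside [S0] are traded for the zeros of [t0]: this
   decouples the part of [t] on the true support from the part off it. *)
Lemma normal_tuple_pdf_swap S0 S t0 t x :
  supp t0 \subset S0 -> supp t \subset S ->
  normal_tuple_pdf t0 x * normal_tuple_pdf t x =
  normal_tuple_pdf (tmask (S :&: S0)%SET t) x *
  normal_tuple_pdf (tadd t0 (tmask (S :\: S0)%SET t)) x.
Proof.
move=> tS0 tS; rewrite /normal_tuple_pdf -!big_split/=; apply: eq_bigr => i _.
rewrite !tnth_mktuple !finset.inE.
have [iS|iS] := boolP (i \in S); last first.
  have -> : tnth t i = 0.
    by apply/eqP/negP => /negP ti; move/negP: iS; apply; apply: (fintype.subsetP tS); rewrite finset.inE.
  by rewrite /= !andbF addr0 mulrC.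
have [iS0|iS0] := boolP (i \in S0) => /=; first by rewrite addr0 mulrC.
have -> : tnth t0 i = 0.
  by apply/eqP/negP => /negP ti; move/negP: iS0; apply; apply: (fintype.subsetP tS0); rewrite finset.inE.
by rewrite add0r.
Qed.

End masks.

(** * Posterior mass of large supports *)

Section dimension_bound.
Context {R : realType} (n : nat).
Variables (w : dim_prior R n) (g : forall k, prob_density R k).
Variables (gamma : forall S : {set 'I_n}, prob_density R #|S|).
Variables (D m1 Cst : R) (theta0 : n.-tuple R).
Hypothesis D0 : 0 < D.
Hypothesis wD : forall k, (1 <= k <= n)%N -> w k <= D * w k.-1.
Hypothesis m10 : 0 < m1.
Hypothesis C0 : 0 < Cst.
Hypothesis g_union : forall (S1 S2 : {set 'I_n}) theta, (S1 \subset ~: S2)%SET ->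
  slab_density g (S1 :|: S2)%SET theta <= Cst * m1 ^+ (#|S1| + #|S2|) *
    gamma S2 (coord_proj S2 theta) * slab_density g S1 theta.

Local Notation S0 := (supp theta0).
Local Open Scope ereal_scope.

Definition slab_evidence x (S : {set 'I_n}) := slab_integral S
  (fun theta => (normal_tuple_pdf theta x * slab_density g S theta)%:E).

(** The [G_S] of the overview: the density of the data when the mean is [theta0] plus a
    [gamma]-distributed vector on S. *)
Definition shifted_marginal (S : {set 'I_n}) x := slab_integral S
  (fun theta => (normal_tuple_pdf (tadd theta0 theta) x *
                 gamma S (coord_proj S theta))%:E).

Let mgamma (S : {set 'I_n}) :
  measurable_fun setT (fun theta : n.-tuple R => gamma S (coord_proj S theta)).
Proof.
rewrite (_ : (fun _ => _) = gamma S \o coord_proj S)//.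
apply: measurableT_comp; first exact: measurable_prob_density.
exact: measurable_coord_proj.
Qed.

Lemma slab_evidence_ge0 x S : 0 <= slab_evidence x S.
Proof.
apply: slab_integral_ge0 => t.
by rewrite lee_fin mulr_ge0 ?normal_tuple_pdf_ge0// slab_density_ge0.
Qed.

Lemma shifted_marginal_ge0 S x : 0 <= shifted_marginal S x.
Proof.
apply: slab_integral_ge0 => t.
by rewrite lee_fin mulr_ge0 ?normal_tuple_pdf_ge0// prob_density_ge0.
Qed.

Lemma measurable_shifted_marginal S : measurable_fun setT (shifted_marginal S).
Proof.
apply: (measurable_fun_fubini_tonelli_F (m2 := lebesgue_tuple #|S|)
  (fun xt => (normal_tuple_pdf (tadd theta0 (@extend0 R n S xt.2)) xt.1 *
              gamma S (coord_proj S (@extend0 R n S xt.2)))%:E)).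
  apply/measurable_EFinP; apply: measurable_funM.
    apply: measurable_normal_tuple_pdf2 => //.
    apply: (measurableT_comp (measurable_tadd theta0)).
    by apply: (measurableT_comp (@measurable_extend0 R n S)).
  apply: (measurableT_comp (mgamma S)).
  by apply: (measurableT_comp (@measurable_extend0 R n S)).
by move=> xt; rewrite lee_fin mulr_ge0 ?normal_tuple_pdf_ge0// prob_density_ge0.
Qed.

(** By Tonelli the data are integrated out first, each normal density giving 1, and then [gamma]. *)
Lemma integral_shifted_marginal S :
  \int[lebesgue_tuple n]_x shifted_marginal S x = 1.
Proof.
rewrite (fubini_tonelli (m2 := lebesgue_tuple #|S|)
  (fun xt => (normal_tuple_pdf (tadd theta0 (@extend0 R n S xt.2)) xt.1 *
              gamma S (coord_proj S (@extend0 R n S xt.2)))%:E)).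
- rewrite -(integral_prob_density (gamma S)); apply: eq_integral => t _ /=.
  under eq_integral do rewrite mulrC EFinM.
  rewrite ge0_integralZl_EFin//.
  + by rewrite integral_normal_tuple_pdf mule1 extend0K.
  + by move=> x _; rewrite lee_fin normal_tuple_pdf_ge0.
  + by apply/measurable_EFinP; exact: measurable_normal_tuple_pdf.
  + exact: prob_density_ge0.
- apply/measurable_EFinP; apply: measurable_funM.
    apply: measurable_normal_tuple_pdf2 => //.
    apply: (measurableT_comp (measurable_tadd theta0)).
    by apply: (measurableT_comp (@measurable_extend0 R n S)).
  apply: (measurableT_comp (mgamma S)).
  by apply: (measurableT_comp (@measurable_extend0 R n S)).
- by move=> xt; rewrite lee_fin mulr_ge0 ?normal_tuple_pdf_ge0// prob_density_ge0.
Qed.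

(** Under the integral, [normal_tuple_pdf_swap] splits the likelihoods and [g_union] the slab
    density. What remains is a function of the coordinates in S1 times a function of those in S2,
    and [slab_integralM] factors it. *)
Lemma slab_evidence_split x (S : {set 'I_n}) :
  (normal_tuple_pdf theta0 x)%:E * slab_evidence x S <=
  (Cst * m1 ^+ #|S|)%:E * (slab_evidence x (S :&: S0)%SET *
                           shifted_marginal (S :\: S0)%SET x).
Proof.
set S1 := (S :&: S0)%SET; set S2 := (S :\: S0)%SET.
have SU : S = (S1 :|: S2)%SET by rewrite setID.
have S12 : (S1 \subset ~: S2)%SET.
  by apply/fintype.subsetP => i; rewrite !finset.inE => /andP[_ ->].
have Scard : #|S| = (#|S1| + #|S2|)%N by rewrite cardsID.
(* The masks make [f1] and [f2] depend on S1 and S2 alone, as [slab_integralM] requires; on vectors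
   extended from these sets they act as the identity. *)
pose f1 theta := (normal_tuple_pdf (tmask S1 theta) x * slab_density g S1 theta)%:E.
pose f2 theta := (normal_tuple_pdf (tadd theta0 (tmask S2 theta)) x *
                  gamma S2 (coord_proj S2 theta))%:E.
have f10 t : 0 <= f1 t.
  by rewrite lee_fin mulr_ge0 ?normal_tuple_pdf_ge0 ?slab_density_ge0.
have f20 t : 0 <= f2 t.
  by rewrite lee_fin mulr_ge0 ?normal_tuple_pdf_ge0 ?prob_density_ge0.
have mf1 : measurable_fun setT f1.
  apply/measurable_EFinP; apply: measurable_funM.
    by apply: measurable_normal_tuple_pdf2 => //; exact: measurable_tmask.
  exact: measurable_slab_density.
have mf2 : measurable_fun setT f2.
  apply/measurable_EFinP; apply: measurable_funM; last exact: mgamma.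
  apply: measurable_normal_tuple_pdf2 => //.
  apply: (measurableT_comp (measurable_tadd theta0)).
  exact: measurable_tmask.
have -> : slab_evidence x S1 = slab_integral S1 f1.
  by apply: eq_integral => t _; rewrite /f1 tmask_extend0.
have -> : shifted_marginal S2 x = slab_integral S2 f2.
  by apply: eq_integral => t _; rewrite /f2 tmask_extend0.
rewrite -slab_integralM//; last 2 first.
- move=> t u tu; rewrite /f1 /slab_density (depends_on_tmask tu).
  by rewrite (depends_on_coord_proj tu).
- move=> t u tu; rewrite /f2 (depends_on_tmask tu).
  by rewrite (depends_on_coord_proj tu).
have K0 : (0 <= Cst * m1 ^+ #|S|)%R by rewrite mulr_ge0 ?exprn_ge0 ?ltW.
rewrite -SU /slab_evidence /slab_integral.
have mext h : measurable_fun setT h ->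
    measurable_fun setT (fun t => h (@extend0 R n S t) : \bar R).
  by move=> mh; exact: (measurableT_comp mh (@measurable_extend0 R n S)).
rewrite -!ge0_integralZl_EFin//; last first.
- exact: normal_tuple_pdf_ge0.
- apply: (mext (fun t => (normal_tuple_pdf t x * slab_density g S t)%:E)).
  apply/measurable_EFinP; apply: measurable_funM.
    exact: measurable_normal_tuple_pdf2.
  exact: measurable_slab_density.
- by move=> t _; rewrite lee_fin mulr_ge0 ?normal_tuple_pdf_ge0 ?slab_density_ge0.
- by apply: (mext (fun t => f1 t * f2 t)); exact: emeasurable_funM.
- by move=> t _; exact: mule_ge0.
apply: le_ge0_integral => t.
  rewrite mule_ge0 ?lee_fin ?normal_tuple_pdf_ge0//.
  by rewrite mulr_ge0 ?normal_tuple_pdf_ge0 ?slab_density_ge0.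
rewrite /f1 /f2 -!EFinM lee_fin [leLHS]mulrA.
rewrite (normal_tuple_pdf_swap x (subxx S0) (supp_extend0 t)) -/S1 -/S2.
set a := normal_tuple_pdf _ x; set b := normal_tuple_pdf _ x.
have := g_union (extend0 t) S12; rewrite -SU -Scard => gU.
have ab0 : (0 <= a * b)%R by rewrite mulr_ge0// normal_tuple_pdf_ge0.
apply: le_trans (ler_wpM2l ab0 gU) _.
by rewrite le_eqVlt; apply/orP; left; apply/eqP; ring.
Qed.

Lemma shifted_marginal_le1 S x : shifted_marginal S x <= 1.
Proof.
rewrite -(integral_prob_density (gamma S)); apply: le_ge0_integral => t.
  by rewrite lee_fin mulr_ge0 ?normal_tuple_pdf_ge0// prob_density_ge0.
rewrite extend0K lee_fin ler_piMl ?prob_density_ge0//.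
exact: normal_tuple_pdf_le1.
Qed.

Lemma shifted_marginal_fin S x : shifted_marginal S x \is a fin_num.
Proof.
rewrite ge0_fin_numE ?shifted_marginal_ge0//.
by rewrite (le_lt_trans (shifted_marginal_le1 _ _))// ltry.
Qed.

Let set_evidence x S := (set_weight w S)%:E * slab_evidence x S.

Let set_evidence_ge0 x S : 0 <= set_evidence x S.
Proof. by rewrite mule_ge0 ?slab_evidence_ge0// lee_fin ltW// set_weight_gt0. Qed.

(** With its part off S0 prescribed, S is determined by its part inside S0, so this is a subsum of
    the evidence. *)
Let sum_evidence_section x (P : pred {set 'I_n}) (S2 : {set 'I_n}) :
  \sum_(S | P S && ((S :\: S0)%SET == S2)) set_evidence x (S :&: S0)%SET <=
  evidence w g x.
Proof.
pose Q := [pred S | P S && ((S :\: S0)%SET == S2)].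
have injQ : {in Q &, injective (fun S : {set 'I_n} => (S :&: S0)%SET)}.
  move=> S T; rewrite !inE => /andP[_ /eqP SS2] /andP[_ /eqP TS2] ST.
  by rewrite -(setID S S0) -(setID T S0) SS2 TS2 ST.
rewrite -(big_imset (set_evidence x) injQ).
by apply: lee_sum_nneg_subset => // S _; exact: set_evidence_ge0.
Qed.

(** After the split, the supports are grouped by their part S2 off S0. At most [#|S0|] elements of S
    lie in S0, so more than K elements in S force at least L in S2. *)
Lemma large_dimension_evidence_le x (K L : nat) : (L + #|S0| <= K.+1)%N ->
  (normal_tuple_pdf theta0 x)%:E *
    \sum_(S : {set 'I_n} | (K < #|S|)%N) (set_weight w S)%:E * slab_evidence x S <=
  (\sum_(S : {set 'I_n} | (S \subset ~: S0)%SET && (L <= #|S|)%N)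
     (union_weight n D m1 Cst #|S0| #|S|)%:E * shifted_marginal S x) * evidence w g x.
Proof.
move=> LK.
have kG0 (S : {set 'I_n}) :
    0 <= (union_weight n D m1 Cst #|S0| #|S|)%:E * shifted_marginal S x.
  rewrite mule_ge0 ?shifted_marginal_ge0// lee_fin.
  exact: union_weight_ge0.
apply: (@le_trans _ _ (\sum_(S : {set 'I_n} | (K < #|S|)%N)
    (union_weight n D m1 Cst #|S0| #|(S :\: S0)%SET|)%:E *
    shifted_marginal (S :\: S0)%SET x * set_evidence x (S :&: S0)%SET)).
  rewrite ge0_sume_distrr; last by move=> S _; exact: set_evidence_ge0.
  apply: lee_sum => S KS; rewrite muleCA.
  apply: (@le_trans _ _ ((set_weight w S)%:E * ((Cst * m1 ^+ #|S|)%:E *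
      (slab_evidence x (S :&: S0)%SET * shifted_marginal (S :\: S0)%SET x)))).
    apply: lee_wpmul2l; first by rewrite lee_fin ltW// set_weight_gt0.
    exact: slab_evidence_split.
  have Scard : #|S| = (#|(S :&: S0)%SET| + #|(S :\: S0)%SET|)%N by rewrite cardsID.
  have S1S0 : (#|(S :&: S0)%SET| <= #|S0|)%N by rewrite subset_leq_card// finset.subsetIr.
  have S0S2 : (#|S0| + #|(S :\: S0)%SET| <= n)%N.
    rewrite -[leqRHS]card_ord -(cardsC S0) leq_add2l subset_leq_card//.
    by apply/fintype.subsetP => i; rewrite !finset.inE => /andP[].
  have := set_weight_union D0 wD m10 C0 S1S0 S0S2 Scard; rewrite -Scard => uwle.
  rewrite muleA -EFinM /set_evidence muleACA -EFinM.
  rewrite [X in _ <= _ * X]muleC.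
  apply: lee_wpmul2r.
    apply: mule_ge0; first exact: slab_evidence_ge0.
    exact: shifted_marginal_ge0.
  by rewrite lee_fin.
rewrite (partition_big (fun S : {set 'I_n} => (S :\: S0)%SET)
  (fun S2 : {set 'I_n} => (S2 \subset ~: S0)%SET && (L <= #|S2|)%N))/=; last first.
  move=> S KS; apply/andP; split.
    by apply/fintype.subsetP => i; rewrite !finset.inE => /andP[].
  rewrite -(leq_add2r #|S0|) (leq_trans LK)// (leq_trans KS)//.
  by rewrite -(cardsID S0 S) addnC leq_add2l subset_leq_card// finset.subsetIr.
rewrite ge0_sume_distrl//; apply: lee_sum => S2 _.
rewrite (eq_bigr (fun S => (union_weight n D m1 Cst #|S0| #|S2|)%:E *
    shifted_marginal S2 x * set_evidence x (S :&: S0)%SET)); last first.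
  by move=> S /andP[_ /eqP ->].
rewrite -ge0_sume_distrr; last by move=> S _; exact: set_evidence_ge0.
by apply: lee_wpmul2l => //; exact: sum_evidence_section.
Qed.

(** Supports larger than K contribute the geometric term. The smaller ones are governed by [h]:
    either they carry at most the fraction [h x] of the evidence, or [h x] exceeds 1 and bounds the
    whole posterior. *)
Lemma expectation_posterior_le (delta : R) (p K : nat)
    (B : set (n.-tuple R)) (h : n.-tuple R -> R) :
  (0 < delta)%R -> (D * m1 * (1 + delta) < 1)%R -> (#|S0| <= p <= K)%N ->
  measurable B -> measurable_fun setT h -> (forall x, 0 <= h x)%R ->
  (forall x, (1 <= h x)%R \/
    \sum_(S : {set 'I_n} | (#|S| <= K)%N) (set_weight w S)%:E *
      slab_integral S (fun theta =>
        (normal_tuple_pdf theta x * slab_density g S theta * \1_B theta)%:E) <=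
    (h x)%:E * evidence w g x) ->
  'E_(normal_tuple theta0)[fun x => posterior w g x B] <=
  (Cst / (1 - D * m1 * (1 + delta)) *
   (Num.max 1 m1 * (1 + delta^-1)) ^+ p * (D * m1 * (1 + delta)) ^+ (K.+1 - p))%:E +
  \int[lebesgue_tuple n]_x (h x * normal_tuple_pdf theta0 x)%:E.
Proof.
move=> delta0 rho1 /andP[S0p pK] mB mh h0 hB.
pose L := (K.+1 - p)%N.
have LK : (L + #|S0| <= K.+1)%N.
  by rewrite -(@subnK p K.+1) ?(leq_trans pK)// leq_add2l.
pose uw := union_weight n D m1 Cst #|S0|.
have uw0 b : (0 <= uw b)%R by exact: union_weight_ge0.
pose F x := \sum_(S : {set 'I_n} | (S \subset ~: S0)%SET && (L <= #|S|)%N)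
  (uw #|S|)%:E * shifted_marginal S x.
have F0 x : 0 <= F x.
  by apply: sume_ge0 => S _; rewrite mule_ge0 ?shifted_marginal_ge0// lee_fin.
have Ffin x : F x \is a fin_num.
  by apply/sum_fin_numP => S _ _; rewrite fin_numM// shifted_marginal_fin.
pose r := [seq S : {set 'I_n} <- index_enum _ | (S \subset ~: S0)%SET && (L <= #|S|)%N].
have FE x : F x = \sum_(S <- r) (uw #|S|)%:E * shifted_marginal S x by rewrite big_filter.
have mF : measurable_fun setT F.
  rewrite (funext FE).
  apply: emeasurable_sum => S.
  by apply: measurable_funeM; exact: measurable_shifted_marginal.
have pdf0 x := normal_tuple_pdf_gt0 theta0 x.
have Fh0 x : (0 <= fine (F x) / normal_tuple_pdf theta0 x)%R.
  by rewrite divr_ge0 ?fine_ge0 ?normal_tuple_pdf_ge0.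
(* The posterior is at most [F / p_theta0 + h]; integrated against [p_theta0], the quotient leaves
   the integral of [F], a weighted sum of probability densities. *)
apply: (@le_trans _ _ (\int[lebesgue_tuple n]_x
    ((F x * ((normal_tuple_pdf theta0 x)^-1)%:E + (h x)%:E) *
     (normal_tuple_pdf theta0 x)%:E))).
  apply: expectation_normal_tuple_le => [x|x|].
  - exact: posterior_ge0.
  - rewrite -(fineK (Ffin x)) -EFinM -EFinD lee_fin.
    have [h1|hx] := hB x.
      by apply: le_trans (posterior_le1 _ _ _ _) _; rewrite (le_trans h1)// lerDr.
    apply: posterior_le => //; first by rewrite addr_ge0.
    rewrite (bigID (fun S : {set 'I_n} => (#|S| <= K)%N))/= EFinD ge0_muleDl ?lee_fin//.
    rewrite [leRHS]addeC; apply: leeD => //.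
    apply: (@le_trans _ _ (\sum_(S : {set 'I_n} | (K < #|S|)%N)
        (set_weight w S)%:E * slab_evidence x S)).
      rewrite (eq_bigl (fun S : {set 'I_n} => (K < #|S|)%N)); last first.
        by move=> S; rewrite -ltnNge.
      apply: lee_sum => S _; apply: lee_wpmul2l.
        by rewrite lee_fin ltW// set_weight_gt0.
      apply: le_ge0_integral => t.
        by rewrite lee_fin !mulr_ge0// ?normal_tuple_pdf_ge0 ?slab_density_ge0.
      by rewrite lee_fin ler_piMr ?mulr_ge0 ?normal_tuple_pdf_ge0 ?slab_density_ge0.
    rewrite EFinM fineK// -muleA [X in _ <= _ * X]muleC muleA lee_pdivlMr// muleC.
    exact: large_dimension_evidence_le.
  - apply: emeasurable_funD; last exact/measurable_EFinP.
    apply: emeasurable_funM => //; apply/measurable_EFinP.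
    exact: measurable_normal_tuple_pdfV.
have FhE x : (F x * ((normal_tuple_pdf theta0 x)^-1)%:E + (h x)%:E) *
    (normal_tuple_pdf theta0 x)%:E = F x + (h x * normal_tuple_pdf theta0 x)%:E.
  rewrite ge0_muleDl ?lee_fin//; last first.
    by rewrite mule_ge0// lee_fin invr_ge0 ltW.
  by rewrite -muleA -EFinM mulVf ?gt_eqF// mule1.
under eq_integral do rewrite FhE.
rewrite ge0_integralD//; last 2 first.
- by move=> x _; rewrite lee_fin mulr_ge0// normal_tuple_pdf_ge0.
- apply/measurable_EFinP; apply: measurable_funM => //.
  exact: measurable_normal_tuple_pdf.
apply: leeD => //.
under eq_integral do rewrite FE.
rewrite ge0_integral_sum//; last 2 first.
- move=> S; apply: measurable_funeM; exact: measurable_shifted_marginal.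
- by move=> S x _; rewrite mule_ge0 ?shifted_marginal_ge0// lee_fin.
rewrite big_filter (eq_bigr (fun S : {set 'I_n} => (uw #|S|)%:E)); last first.
  by move=> S _; rewrite ge0_integralZl_EFin ?integral_shifted_marginal ?mule1//;
    [move=> x _; exact: shifted_marginal_ge0|exact: measurable_shifted_marginal].
rewrite sumEFin lee_fin.
have S0C : #|(~: S0)%SET| = (n - #|S0|)%N.
  by rewrite -[X in (X - _)%N](card_ord n) -(cardsC S0) addKn.
apply: le_trans (sum_union_weight D0 m10 C0 delta0 L S0C rho1) _.
rewrite ler_pM2r; last by rewrite exprn_gt0// !mulr_gt0// addr_gt0.
rewrite ler_pM2l; last by rewrite divr_gt0// subr_gt0.
rewrite ler_weXn2l// mulr_ege1// ?le_max ?lexx// lerDl invr_ge0 ltW//.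
Qed.

(** A slab on at most K coordinates does not meet the set of vectors with more than K nonzero
    entries, so [h = 0] is allowed. *)
Lemma expectation_posterior_dimension_le (delta : R) (p K : nat) :
  (0 < delta)%R -> (D * m1 * (1 + delta) < 1)%R -> (#|S0| <= p <= K)%N ->
  'E_(normal_tuple theta0)[fun x => posterior w g x
     [set theta : n.-tuple R | (K < #|supp theta|)%N]] <=
  (Cst / (1 - D * m1 * (1 + delta)) *
   (Num.max 1 m1 * (1 + delta^-1)) ^+ p * (D * m1 * (1 + delta)) ^+ (K.+1 - p))%:E.
Proof.
move=> delta0 rho1 S0pK.
apply: le_trans (expectation_posterior_le (h := cst 0%R) delta0 rho1 S0pK
  (measurable_supp_gt K) _ _ _) _ => //.
- move=> x; right; rewrite mul0e big1// => S SK.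
  rewrite (_ : slab_integral _ _ = 0) ?mule0//.
  rewrite /slab_integral integral0_eq// => t _.
  rewrite indicE memNset ?mulr0// /mkset; apply/negP; rewrite -leqNgt.
  exact: leq_trans (subset_leq_card (supp_extend0 t)) SK.
- by rewrite integral0_eq ?adde0// => x _; rewrite mul0r.
Qed.

End dimension_bound.

(** * Likelihood ratios and uniform control of the noise *)

Section likelihood_ratio.
Context {R : realType} (n : nat).
Implicit Types (S T : {set 'I_n}) (t x : n.-tuple R).

Definition sqdist t u : R := \sum_(i < n) (tnth t i - tnth u i) ^+ 2.

Lemma normal_tuple_pdf_ratio t t0 x : normal_tuple_pdf t x =
  normal_tuple_pdf t0 x * expR (\sum_(i < n)
    ((tnth x i - tnth t0 i) * (tnth t i - tnth t0 i)
     - 2^-1 * (tnth t i - tnth t0 i) ^+ 2)).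
Proof.
rewrite !normal_tuple_pdfE -mulrA -expRD; congr (_ * expR _).
rewrite !mulNr !mulr_suml -!sumrN -big_split/=; apply: eq_bigr => i _.
by field.
Qed.

Lemma supp_out S t i : supp t \subset S -> i \notin S -> tnth t i = 0.
Proof.
move=> tS; apply: contraNeq => ti; apply: (fintype.subsetP tS).
by rewrite finset.inE.
Qed.

(** With noise [a] and displacement [b] in a coordinate of T, the claim is
    [a b - b^2 / 2 <= a^2 - b^2 / 4], that is [(a - b / 2)^2 >= 0]. Off T the displacement is 0. *)
Lemma normal_tuple_pdf_le T t t0 x : supp t \subset T -> supp t0 \subset T ->
  normal_tuple_pdf t x <= normal_tuple_pdf t0 x *
    expR (\sum_(i in T) (tnth x i - tnth t0 i) ^+ 2 - 4^-1 * sqdist t t0).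
Proof.
move=> tT t0T; rewrite (normal_tuple_pdf_ratio t t0) ler_pM2l ?normal_tuple_pdf_gt0//.
rewrite ler_expR /sqdist mulr_sumr -sumrN [X in _ <= X + _]big_mkcond -big_split/=.
apply: ler_sum => i _; case: ifPn => [_|iT]; last first.
  by rewrite (supp_out tT iT) (supp_out t0T iT) subrr expr0n /= !mulr0 !subr0.
rewrite -subr_ge0.
have -> : (tnth x i - tnth t0 i) ^+ 2 - 4^-1 * (tnth t i - tnth t0 i) ^+ 2 -
    ((tnth x i - tnth t0 i) * (tnth t i - tnth t0 i) -
    2^-1 * (tnth t i - tnth t0 i) ^+ 2) =
    ((tnth x i - tnth t0 i) - 2^-1 * (tnth t i - tnth t0 i)) ^+ 2 by field.
exact: sqr_ge0.
Qed.

(* A product of heavy exponential moments: its size controls simultaneously the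
   noise on every subset of coordinates. *)
Definition noise_product (eta : R) t0 x : R :=
  \prod_(i < n) (1 + eta * expR (4^-1 * (tnth x i - tnth t0 i) ^+ 2)).

Lemma noise_product_ge0 eta t0 x : 0 <= eta -> 0 <= noise_product eta t0 x.
Proof. by move=> e0; apply: prodr_ge0 => i _; rewrite addr_ge0// mulr_ge0// expR_ge0. Qed.

Lemma measurable_noise_product eta t0 :
  measurable_fun setT (noise_product eta t0).
Proof.
apply: measurable_prod => i _; apply: measurable_funD => //.
apply: measurable_funM => //; apply: measurableT_comp => //.
apply: measurable_funM => //; apply: measurable_funX.
by apply: measurable_funB => //; exact: measurable_tnth.
Qed.

(** Every factor of the product is at least 1 and at least its exponential part; the first bound is
    used off T, the second on T. One event thus controls all sets T, in place of a union bound. *)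
Lemma noise_le eta t0 x T c : 0 < eta -> noise_product eta t0 x <= expR c ->
  \sum_(i in T) (tnth x i - tnth t0 i) ^+ 2 <= 4 * (#|T|%:R * - ln eta + c).
Proof.
move=> e0 Wc.
have : expR (\sum_(i in T) (4^-1 * (tnth x i - tnth t0 i) ^+ 2 + ln eta)) <= expR c.
  apply: le_trans Wc; rewrite expR_sum /noise_product big_mkcond/=.
  apply: ler_prod => i _; case: ifP => _; last first.
    by rewrite ler01 lerDl mulr_ge0 ?expR_ge0// ltW.
  by rewrite expR_ge0 expRD lnK ?posrE// [expR _ * _]mulrC lerDr ler01.
rewrite ler_expR big_split/= sumr_const -mulr_sumr -[ln eta *+ _]mulr_natl => H.
rewrite -ler_pdivrMl//; move: H.
by rewrite -lerBrDr mulrN addrC.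
Qed.

(** The integral factors over coordinates. For a standard normal Z, [exp (Z^2 / 4)] has mean
    [sqrt 2 <= 2], and [1 + 2 eta <= exp (2 eta)]. *)
Lemma integral_noise_product (eta : R) t0 : 0 <= eta ->
  (\int[lebesgue_tuple n]_x (noise_product eta t0 x * normal_tuple_pdf t0 x)%:E <=
   (expR (2 * eta * n%:R))%:E)%E.
Proof.
move=> e0; pose h i y : R := (1 + eta * expR (4^-1 * (y - tnth t0 i) ^+ 2)) *
  normal_pdf (tnth t0 i) 1 y.
have mh i : measurable_fun setT (h i).
  apply: measurable_funM; last exact: measurable_normal_pdf.
  apply: measurable_funD => //; apply: measurable_funM => //.
  apply: measurableT_comp => //; apply: measurable_funM => //.
  by apply: measurable_funX; exact: measurable_funB.
have h0 i y : 0 <= h i y.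
  by rewrite mulr_ge0 ?normal_pdf_ge0// addr_ge0// mulr_ge0// expR_ge0.
under eq_integral do rewrite -big_split/=.
rewrite (integral_lebesgue_tuple_prod mh h0).
have s2 : (Num.sqrt 2 : R) <= 2.
  rewrite -[leRHS]gtr0_norm// -sqrtr_sqr ler_sqrt// expr2; lra.
have hE i : (\int[lebesgue_measure]_y (h i y)%:E = (1 + eta * Num.sqrt 2)%:E)%E.
  have hhE y : (h i y)%:E = ((normal_pdf (tnth t0 i) 1 y)%:E +
      (eta * normal_peak 1)%:E * (expR (- 4^-1 * (y - tnth t0 i) ^+ 2))%:E)%E.
    rewrite /h mulrDl mul1r EFinD -EFinM; congr (_ + _%:E)%E.
    rewrite normal_pdfE ?oner_neq0// /normal_fun.
    rewrite -!mulrA; congr (_ * _); rewrite mulrCA; congr (_ * _).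
    by rewrite -expRD; congr expR; rewrite expr1n -mulr_natr; field.
  under eq_integral do rewrite hhE.
  have pk0 : 0 <= eta * normal_peak 1 by rewrite mulr_ge0// normal_peak_ge0.
  have mex : measurable_fun setT (fun y : R =>
      (expR (- 4^-1 * (y - tnth t0 i) ^+ 2))%:E).
    apply/measurable_EFinP; apply: measurableT_comp => //.
    by apply: measurable_funM => //; apply: measurable_funX; exact: measurable_funB.
  rewrite ge0_integralD//; last 4 first.
  - by move=> y _; rewrite lee_fin normal_pdf_ge0.
  - by apply/measurable_EFinP; exact: measurable_normal_pdf.
  - by move=> y _; rewrite -EFinM lee_fin mulr_ge0// expR_ge0.
  - exact: measurable_funeM.
  rewrite integral_normal_pdf ge0_integralZl_EFin//.
  rewrite integral_expR_square ?invr_gt0// -EFinM -EFinD; congr (_ + _)%:E.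
  rewrite -mulrA; congr (_ * _); rewrite /normal_peak -sqrtrV; last first.
    by rewrite -mulr_natr mulr_ge0// mulr_ge0// pi_ge0.
  rewrite -sqrtrM; last by rewrite invr_ge0 -mulr_natr mulr_ge0// mulr_ge0// pi_ge0.
  congr Num.sqrt; rewrite expr1n mul1r -mulr_natr invrK; move: (pi_gt0 R); move: (@pi R) => P P0; field.
  by rewrite gt_eqF.
under eq_bigr do rewrite hE.
rewrite prodEFin lee_fin prodr_const card_ord.
rewrite [2 * eta * _]mulrC expRM_natl lerXn2r ?nnegrE ?expR_ge0//.
  by rewrite addr_ge0// mulr_ge0// sqrtr_ge0.
apply: le_trans (expR_ge1Dx _); rewrite lerD2l mulrC ler_wpM2r//.
Qed.

End likelihood_ratio.

(** * Posterior mass far from the true parameter *)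

Section distance_bound.
Context {R : realType} (n : nat).
Variables (w : dim_prior R n) (g : forall k, prob_density R k).
Variables (gamma : forall S : {set 'I_n}, prob_density R #|S|).
Variables (D m1 Cst c1 : R) (theta0 : n.-tuple R) (Ss : {set 'I_n}).
Hypothesis D0 : 0 < D.
Hypothesis wD : forall k, (1 <= k <= n)%N -> w k <= D * w k.-1.
Hypothesis m10 : 0 < m1.
Hypothesis C0 : 0 < Cst.
Hypothesis g_union : forall (S1 S2 : {set 'I_n}) theta, (S1 \subset ~: S2)%SET ->
  slab_density g (S1 :|: S2)%SET theta <= Cst * m1 ^+ (#|S1| + #|S2|) *
    gamma S2 (coord_proj S2 theta) * slab_density g S1 theta.
Hypothesis c10 : 0 <= c1.
Hypothesis g_lip : forall (S : {set 'I_n}) t u,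
  slab_density g S t <= slab_density g S u *
    expR (c1 * #|S|%:R + 64^-1 * \sum_(i in S) (tnth t i - tnth u i) ^+ 2).
Hypothesis g_proj_le : forall (S T : {set 'I_n}) t, S \subset T ->
  slab_density g T t <= slab_density g S t *
    expR (c1 * #|T|%:R + 64^-1 * \sum_(i in (T :\: S)%SET) tnth t i ^+ 2).
Hypothesis g_proj_ge : forall (S T : {set 'I_n}) t, S \subset T ->
  slab_density g S t <= slab_density g T t *
    expR (c1 * #|T|%:R + 64^-1 * \sum_(i in (T :\: S)%SET) tnth t i ^+ 2).
Hypothesis theta0Ss : supp theta0 \subset Ss.

Let sum_sq_le_sqdist (S : {set 'I_n}) t :
  \sum_(i in S) (tnth t i - tnth theta0 i) ^+ 2 <= sqdist t theta0.
Proof.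
rewrite big_mkcond; apply: ler_sum => i _; case: ifP => // _; exact: sqr_ge0.
Qed.

Let sum_sq_out (S T : {set 'I_n}) (t : n.-tuple R) : supp t \subset S ->
  \sum_(i in (T :\: S)%SET) tnth t i ^+ 2 = 0.
Proof.
move=> tS; rewrite big1// => i; rewrite finset.inE => /andP[iS _].
by rewrite (supp_out tS iS) expr0n.
Qed.

(** The comparison goes through the union T: from S up to T at [t], from [t] to [theta0] on T, and
    down from T to [Ss] at [theta0]. Each passage costs [c1 * #|T|]; the two projections add nothing
    since the discarded coordinates vanish. *)
Lemma slab_density_upper (S : {set 'I_n}) (t : n.-tuple R) N : supp t \subset S ->
  (#|S| + #|Ss| <= N)%N ->
  slab_density g S t <= slab_density g Ss theta0 *
    expR (3 * c1 * N%:R + 64^-1 * sqdist t theta0).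
Proof.
move=> tS SN; set T := (S :|: Ss)%SET.
have ST : S \subset T by exact: finset.subsetUl.
have SsT : Ss \subset T by exact: finset.subsetUr.
have TN : (#|T| <= N)%N by rewrite (leq_trans _ SN)// cardsU leq_subr.
apply: le_trans (g_proj_ge t ST) _; rewrite sum_sq_out// mulr0 addr0.
apply: (@le_trans _ _ (slab_density g T theta0 * expR (c1 * #|T|%:R +
    64^-1 * sqdist t theta0) * expR (c1 * #|T|%:R))).
  rewrite ler_wpM2r ?expR_ge0// (le_trans (g_lip T t theta0))//.
  rewrite ler_wpM2l ?slab_density_ge0// ler_expR lerD2l ler_wpM2l//.
apply: (@le_trans _ _ (slab_density g Ss theta0 * expR (c1 * #|T|%:R) *
    expR (c1 * #|T|%:R + 64^-1 * sqdist t theta0) * expR (c1 * #|T|%:R))).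
  rewrite !ler_wpM2r ?expR_ge0// (le_trans (g_proj_le theta0 SsT))//.
  by rewrite sum_sq_out// mulr0 addr0.
rewrite -!mulrA ler_wpM2l ?slab_density_ge0// -!expRD ler_expR.
have : c1 * #|T|%:R <= c1 * N%:R by rewrite ler_wpM2l// ler_nat.
lra.
Qed.

(** Only the support [Ss] is kept. Around [theta0] the integrand is bounded below by a product of
    one-dimensional exponentials of quadratics, each with integral at least 1 whatever its linear
    coefficient. *)
Lemma evidence_lower x :
  ((set_weight w Ss * (normal_tuple_pdf theta0 x * slab_density g Ss theta0 *
    expR (- (c1 * #|Ss|%:R))))%:E <= evidence w g x)%E.
Proof.
(* The coefficient 33/64 is 1/2 from the likelihood plus 1/64 from the slab condition. *)
pose h i (y : R) : R := expR ((tnth x i - tnth theta0 i) * (y - tnth theta0 i) -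
  33 / 64 * (y - tnth theta0 i) ^+ 2).
have mh i : measurable_fun setT (h i) by exact: measurable_expR_quadratic.
have h0 i y : 0 <= h i y by exact: expR_ge0.
have h1 : (1 <= slab_integral Ss (fun t => (\prod_(i in Ss) h i (tnth t i))%:E))%E.
  rewrite slab_integral_prod//.
  elim/big_ind: _ => // [a b a1 b1|i _].
    by rewrite -[leLHS]mule1; apply: lee_pmul => //; rewrite lee_fin.
  have a0 : 0 < 33 / 64 :> R by rewrite divr_gt0.
  apply: le_trans _ (ge_integral_expR_quadratic _ _ a0).
  have pi2 := pi_ge2 R.
  by rewrite lee_fin -[leLHS]sqrtr1 ler_sqrt; lra.
set K := normal_tuple_pdf theta0 x * slab_density g Ss theta0 *
  expR (- (c1 * #|Ss|%:R)).
have K0 : 0 <= K by rewrite !mulr_ge0 ?expR_ge0 ?normal_tuple_pdf_ge0 ?slab_density_ge0.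
have ev : (K%:E <= slab_evidence g x Ss)%E.
  apply: (@le_trans _ _ (K%:E *
      slab_integral Ss (fun t => (\prod_(i in Ss) h i (tnth t i))%:E))%E).
    rewrite -[leLHS]mule1; apply: lee_wpmul2l; [by rewrite lee_fin|exact: h1].
  rewrite /slab_integral -ge0_integralZl_EFin//; last 2 first.
  - by move=> t _; rewrite lee_fin prodr_ge0.
  - have mp : measurable_fun setT (fun t : n.-tuple R => \prod_(i in Ss) h i (tnth t i)).
      under eq_fun do rewrite big_mkcond.
      apply: measurable_prod => i _; case: (i \in Ss) => //.
      by apply: (measurableT_comp (mh i)); exact: measurable_tnth.
    by apply/measurable_EFinP; exact: (measurableT_comp mp (@measurable_extend0 R n Ss)).
  apply: le_ge0_integral => t'; rewrite -EFinM lee_fin.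
    by rewrite mulr_ge0// prodr_ge0.
  set t := extend0 t'; have tS : supp t \subset Ss by exact: supp_extend0.
  rewrite (normal_tuple_pdf_ratio t theta0) /K -!mulrA ler_wpM2l ?normal_tuple_pdf_ge0//.
  have := g_lip Ss theta0 t.
  set G := slab_density g Ss theta0; set G' := slab_density g Ss t.
  set s := \sum_(i in Ss) _ => GG'.
  have G'0 : 0 <= G' by exact: slab_density_ge0.
  apply: (@le_trans _ _ (G' * expR (c1 * #|Ss|%:R + 64^-1 * s) *
      (expR (- (c1 * #|Ss|%:R)) * \prod_(i in Ss) h i (tnth t i)))).
    by rewrite ler_wpM2r// mulr_ge0 ?expR_ge0// prodr_ge0.
  rewrite -mulrA [leRHS]mulrC ler_wpM2l// -expR_sum -!expRD ler_expR.
  rewrite (_ : \sum_(i < n) _ = \sum_(i in Ss) ((tnth x i - tnth theta0 i) *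
      (tnth t i - tnth theta0 i) - 2^-1 * (tnth t i - tnth theta0 i) ^+ 2)); last first.
    rewrite [RHS]big_mkcond; apply: eq_bigr => i _; case: ifPn => // iS.
    by rewrite (supp_out tS iS) (supp_out theta0Ss iS) subrr expr0n /= !mulr0 subr0.
  rewrite !sumrB -!mulr_sumr.
  have -> : s = \sum_(i in Ss) (tnth t i - tnth theta0 i) ^+ 2.
    by apply: eq_bigr => i _; rewrite -sqrrN opprB.
  by rewrite le_eqVlt; apply/orP; left; apply/eqP; field.
rewrite /evidence (bigD1 Ss)//= EFinM.
apply: le_trans (leeDl _ _); last first.
  apply: sume_ge0 => S _; rewrite mule_ge0 ?slab_evidence_ge0// lee_fin ltW//.
  exact: set_weight_gt0.
by apply: lee_wpmul2l => //; rewrite lee_fin ltW// set_weight_gt0.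
Qed.

(** The integral of [exp (- y^2 / 16)] over the line. *)
Let G : R := Num.sqrt (pi / 16^-1).

(** The likelihood gives -1/4 and the slab +1/64 of the squared distance, in total -15/64. A share
    of 11/64 is turned into [V]; the remaining 1/16 makes the integral over the slab finite, at most
    [G ^ K]. The weights sum to 1. *)
Lemma numerator_upper x (B : set (n.-tuple R)) (V Q : R) (K : nat) :
  (forall t, (#|supp t| <= K)%N -> B t -> V <= sqdist t theta0) ->
  (forall T : {set 'I_n}, (#|T| <= K + #|Ss|)%N ->
    \sum_(i in T) (tnth x i - tnth theta0 i) ^+ 2 <= Q) ->
  (\sum_(S : {set 'I_n} | (#|S| <= K)%N) (set_weight w S)%:E *
    slab_integral S (fun t =>
      (normal_tuple_pdf t x * slab_density g S t * \1_B t)%:E) <=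
  (normal_tuple_pdf theta0 x * slab_density g Ss theta0 *
   expR (Q + 3 * c1 * (K + #|Ss|)%:R - 11 / 64 * V) * G ^+ K)%:E)%E.
Proof.
move=> BV HQ; set A := normal_tuple_pdf theta0 x * _ * _.
have A0 : 0 <= A by rewrite !mulr_ge0 ?expR_ge0 ?normal_tuple_pdf_ge0 ?slab_density_ge0.
have a0 : 0 < 16^-1 :> R by rewrite invr_gt0.
have G1 : 1 <= G.
  by have pi2 := pi_ge2 R; rewrite /G -[leLHS]sqrtr1 ler_sqrt; lra.
have G0 : 0 <= G by exact: le_trans G1.
pose h i (y : R) : R := expR (- 16^-1 * (y - tnth theta0 i) ^+ 2).
have mh i : measurable_fun setT (h i).
  apply: measurableT_comp => //; apply: measurable_funM => //.
  by apply: measurable_funX; exact: measurable_funB.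
have h0 i y : 0 <= h i y by exact: expR_ge0.
have slabS (S : {set 'I_n}) : (#|S| <= K)%N -> (slab_integral S (fun t =>
    (normal_tuple_pdf t x * slab_density g S t * \1_B t)%:E) <= (A * G ^+ K)%:E)%E.
  move=> SK.
  apply: (@le_trans _ _ (A%:E *
      slab_integral S (fun t => (\prod_(i in S) h i (tnth t i))%:E))%E); last first.
    rewrite slab_integral_prod//.
    under eq_bigr do rewrite integral_expR_square//.
    rewrite prodEFin prodr_const -EFinM lee_fin ler_wpM2l//.
    by rewrite ler_weXn2l.
  rewrite /slab_integral -ge0_integralZl_EFin//; last 2 first.
  - by move=> t _; rewrite lee_fin prodr_ge0.
  - have mp : measurable_fun setT (fun t : n.-tuple R => \prod_(i in S) h i (tnth t i)).
      under eq_fun do rewrite big_mkcond.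
      apply: measurable_prod => i _; case: (i \in S) => //.
      by apply: (measurableT_comp (mh i)); exact: measurable_tnth.
    by apply/measurable_EFinP; exact: (measurableT_comp mp (@measurable_extend0 R n S)).
  apply: le_ge0_integral => t'.
    by rewrite lee_fin !mulr_ge0 ?normal_tuple_pdf_ge0 ?slab_density_ge0.
  set t := extend0 t'; have tS : supp t \subset S by exact: supp_extend0.
  rewrite -EFinM lee_fin indicE; have [Bt|Bt] := boolP (t \in B); last first.
    by rewrite mulr0 mulr_ge0// prodr_ge0.
  rewrite mulr1; move/set_mem : Bt.
  move=> /(BV _ (leq_trans (subset_leq_card tS) SK)) Vt.
  set T := (S :|: Ss)%SET.
  have tT : supp t \subset T by apply: fintype.subset_trans tS _; exact: finset.subsetUl.
  have t0T : supp theta0 \subset T.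
    by apply: fintype.subset_trans theta0Ss _; exact: finset.subsetUr.
  have TK : (#|T| <= K + #|Ss|)%N.
    apply: (@leq_trans (#|S| + #|Ss|)%N); last by rewrite leq_add2r.
    by rewrite cardsU leq_subr.
  have SKs : (#|S| + #|Ss| <= K + #|Ss|)%N by rewrite leq_add2r.
  apply: le_trans (ler_pM (normal_tuple_pdf_ge0 _ _) (slab_density_ge0 _ _ _)
    (normal_tuple_pdf_le x tT t0T) (slab_density_upper tS SKs)) _.
  have := HQ T TK; set eT := \sum_(i in T) _ => eTQ.
  rewrite /A mulrACA -!mulrA ler_wpM2l ?normal_tuple_pdf_ge0//.
  rewrite ler_wpM2l ?slab_density_ge0//.
  rewrite -expR_sum -!expRD ler_expR -mulr_sumr.
  have := sum_sq_le_sqdist S t; set sS := \sum_(i in S) _ => sSle.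
  lra.
apply: (@le_trans _ _ (\sum_(S : {set 'I_n}) (set_weight w S)%:E * (A * G ^+ K)%:E)%E).
  rewrite big_mkcond; apply: lee_sum => S _; case: ifP => SK.
    by apply: lee_wpmul2l; [rewrite lee_fin ltW// set_weight_gt0|exact: slabS].
  rewrite -EFinM lee_fin; apply: mulr_ge0; first by rewrite ltW// set_weight_gt0.
  by apply: mulr_ge0 => //; exact: exprn_ge0.
rewrite -ge0_sume_distrl; last by move=> S _; rewrite lee_fin ltW// set_weight_gt0.
by rewrite sumEFin sum_set_weight// mul1e.
Qed.

(** The last hypothesis compares [numerator_upper] with [evidence_lower] when the noise is moderate,
    giving the fraction [eta]; exceptional noise costs [exp (- p)]. *)
Lemma expectation_posterior_distance_le (delta : R) (p K : nat)
    (B : set (n.-tuple R)) (V eta : R) :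
  0 < delta -> D * m1 * (1 + delta) < 1 -> #|Ss| = p -> (0 < p <= K)%N ->
  measurable B -> (forall t, (#|supp t| <= K)%N -> B t -> V <= sqdist t theta0) -> 0 <= eta ->
  expR (4 * ((K + p)%:R * - ln (p%:R / n%:R) + 3 * p%:R) +
        3 * c1 * (K + p)%:R + c1 * p%:R - 11 / 64 * V) * G ^+ K <=
    eta * set_weight w Ss ->
  ('E_(normal_tuple theta0)[fun x => posterior w g x B] <=
  (Cst / (1 - D * m1 * (1 + delta)) *
   (Num.max 1 m1 * (1 + delta^-1)) ^+ p * (D * m1 * (1 + delta)) ^+ (K.+1 - p) +
   (expR (- p%:R) + eta))%:E)%E.
Proof.
move=> delta0 rho1 Ssp /andP[p0 pK] mB BV eta0 Heta.
have pn : (p <= n)%N by rewrite -Ssp -[leqRHS]card_ord max_card.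
have n0 : (0 < n)%N by exact: leq_trans pn.
have pn0 : 0 < p%:R / n%:R :> R by rewrite divr_gt0// ltr0n.
have lnpn : 0 <= - ln (p%:R / n%:R) :> R.
  by rewrite oppr_ge0 ln_le0// ler_pdivrMr ?ltr0n// mul1r ler_nat.
pose W := noise_product (p%:R / n%:R) theta0.
have W0 x : 0 <= W x by rewrite noise_product_ge0// ltW.
(* If [W] exceeds [exp (3 p)] then [h] is at least 1. As [W] has mean at most [exp (2 p)], the first
   summand has mean at most [exp (- p)]. *)
pose h x := W x * expR (- (3 * p%:R)) + eta.
have h0 x : 0 <= h x by rewrite addr_ge0// mulr_ge0// expR_ge0.
have mh : measurable_fun setT h.
  by apply: measurable_funD => //; apply: measurable_funM => //; exact: measurable_noise_product.
have S0p : (#|supp theta0| <= p <= K)%N by rewrite pK andbT -Ssp subset_leq_card.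
have hB x : 1 <= h x \/ (\sum_(S : {set 'I_n} | (#|S| <= K)%N) (set_weight w S)%:E *
    slab_integral S (fun t =>
      (normal_tuple_pdf t x * slab_density g S t * \1_B t)%:E) <=
    (h x)%:E * evidence w g x)%E.
  have [Wx|Wx] := leP (W x) (expR (3 * p%:R)); last first.
    left; rewrite /h -[leLHS]addr0 lerD//.
    by rewrite expRN ler_pdivlMr ?expR_gt0// mul1r ltW.
  right; set Q := 4 * ((K + p)%:R * - ln (p%:R / n%:R) + 3 * p%:R) in Heta *.
  have HQ (T : {set 'I_n}) : (#|T| <= K + #|Ss|)%N ->
      \sum_(i in T) (tnth x i - tnth theta0 i) ^+ 2 <= Q.
    move=> TK; apply: le_trans (noise_le T pn0 Wx) _.
    by rewrite ler_wpM2l// lerD2r ler_wpM2r// ler_nat -Ssp.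
  apply: le_trans (numerator_upper BV HQ) _.
  apply: le_trans (_ : (eta%:E * evidence w g x <= _)%E); last first.
    apply: lee_wpmul2r; last by rewrite lee_fin lerDr mulr_ge0// expR_ge0.
    apply: le_trans (evidence_lower x); rewrite lee_fin.
    apply: mulr_ge0; first by rewrite ltW// set_weight_gt0.
    by rewrite !mulr_ge0 ?expR_ge0 ?normal_tuple_pdf_ge0 ?slab_density_ge0.
  apply: le_trans (lee_wpmul2l _ (evidence_lower x)); last by rewrite lee_fin.
  rewrite -EFinM lee_fin Ssp.
  have := ler_wpM2r (expR_ge0 (- (c1 * p%:R))) Heta.
  rewrite mulrAC -expRD => H.
  have pg0 : 0 <= normal_tuple_pdf theta0 x * slab_density g Ss theta0.
    by rewrite mulr_ge0 ?normal_tuple_pdf_ge0 ?slab_density_ge0.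
  have := ler_wpM2l pg0 H.
  set a := normal_tuple_pdf _ _; set b := slab_density _ _ _; set s := set_weight _ _.
  rewrite (_ : Q + 3 * c1 * (K + p)%:R + c1 * p%:R - 11 / 64 * V + - (c1 * p%:R) =
    Q + 3 * c1 * (K + p)%:R - 11 / 64 * V); last by ring.
  rewrite !mulrA => /le_trans; apply.
  by rewrite le_eqVlt; apply/orP; left; apply/eqP; ring.
apply: le_trans (expectation_posterior_le D0 wD m10 C0 g_union delta0 rho1 S0p mB mh h0 hB) _.
rewrite EFinD; apply: leeD => //.
have hE x : (h x * normal_tuple_pdf theta0 x)%:E =
    ((expR (- (3 * p%:R)))%:E * (W x * normal_tuple_pdf theta0 x)%:E +
     eta%:E * (normal_tuple_pdf theta0 x)%:E)%E.
  by rewrite -!EFinM -EFinD; congr EFin; rewrite /h; ring.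
under eq_integral do rewrite hE.
have mpdf := measurable_normal_tuple_pdf theta0.
have mWp : measurable_fun setT (fun x => (W x * normal_tuple_pdf theta0 x)%:E).
  by apply/measurable_EFinP; apply: measurable_funM => //; exact: measurable_noise_product.
have Wp0 x : (0 <= (W x * normal_tuple_pdf theta0 x)%:E)%E.
  by rewrite lee_fin mulr_ge0// normal_tuple_pdf_ge0.
have p0' x : (0 <= (normal_tuple_pdf theta0 x)%:E)%E by rewrite lee_fin normal_tuple_pdf_ge0.
have mp' : measurable_fun setT (fun x => (normal_tuple_pdf theta0 x)%:E).
  exact/measurable_EFinP.
rewrite ge0_integralD//; last 4 first.
- by move=> x _; rewrite mule_ge0// lee_fin expR_ge0.
- exact: measurable_funeM.
- by move=> x _; rewrite mule_ge0// lee_fin.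
- exact: measurable_funeM.
rewrite !ge0_integralZl_EFin ?expR_ge0// integral_normal_tuple_pdf mule1 EFinD.
apply: leeD => //.
apply: le_trans (lee_wpmul2l _ (integral_noise_product theta0 (ltW pn0))) _.
  by rewrite lee_fin expR_ge0.
rewrite -EFinM lee_fin -expRD ler_expR.
have -> : 2 * (p%:R / n%:R) * n%:R = 2 * p%:R :> R.
  by rewrite -mulrA divfK// gt_eqF// ltr0n.
lra.
Qed.

End distance_bound.

(** * From extended logarithms to multiplicative bounds on the slabs *)

Section log_bounds.
Context {R : realType}.

(* [lne 0 = -oo] and [-oo - -oo = -oo], so the bounds survive at zeros of [a], [b]. *)
Lemma lne_sub_le (a b r : R) : 0 <= a -> 0 <= b ->
  (lne a%:E - lne b%:E <= r%:E)%E -> a <= b * expR r.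
Proof.
rewrite le_eqVlt => /orP[/eqP <- b0 _|a0]; first by rewrite mulr_ge0// expR_ge0.
rewrite le_eqVlt => /orP[/eqP <-|b0]; first by rewrite lne_EFin// le0_lneNy.
rewrite !lne_EFin// -EFinB lee_fin lerBlDl => H.
by rewrite -[leLHS]lnK ?posrE// -[X in X * _]lnK ?posrE// -expRD ler_expR.
Qed.

Lemma lne_dist_le (a b r : R) : 0 <= a -> 0 <= b ->
  (`|lne a%:E - lne b%:E| <= r%:E)%E -> a <= b * expR r /\ b <= a * expR r.
Proof.
rewrite le_eqVlt => /orP[/eqP <-|a0]; rewrite le_eqVlt => /orP[/eqP <-|b0].
- by rewrite mul0r.
- by rewrite le0_lneNy// lne_EFin.
- by rewrite lne_EFin// le0_lneNy.
rewrite !lne_EFin// -EFinB lee_fin => H; split; apply: lne_sub_le.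
- exact: ltW.
- exact: ltW.
- by rewrite !lne_EFin// -EFinB lee_fin; apply: le_trans (ler_norm _) H.
- exact: ltW.
- exact: ltW.
- by rewrite !lne_EFin// -EFinB lee_fin -opprB; apply: le_trans (ler_norm _) _; rewrite normrN.
Qed.

Lemma enorm_tsub_coord_proj n (S : {set 'I_n}) (t u : n.-tuple R) :
  enorm (tsub (coord_proj S t) (coord_proj S u)) ^+ 2 =
  \sum_(i in S) (tnth t i - tnth u i) ^+ 2.
Proof.
rewrite sqr_sqrtr; last by apply: sumr_ge0 => i _; exact: sqr_ge0.
by rewrite [RHS]big_enum_val; apply: eq_bigr => i _; rewrite !tnth_mktuple.
Qed.

End log_bounds.

(** * From squared Euclidean distance to [dq] *)

Section power_distance.
Context {R : realType}.

(** The right side is the tangent at 1 of a concave function. For [s < 1] it is Young's inequality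
    with exponents [1 / s] and [1 / (1 - s)]; the latter degenerates at [s = 1], treated apart. *)
Lemma powR_tangent (s z : R) : 0 < s <= 1 -> 0 <= z -> z `^ s <= 1 - s + s * z.
Proof.
move=> /andP[s0 s1] z0; move: s1; rewrite le_eqVlt => /orP[/eqP ->|s1].
  by rewrite powRr1// subrr add0r mul1r.
have t0 : 0 < 1 - s by rewrite subr_gt0.
have := @conjugate_powR R (z `^ s) 1 s^-1 (1 - s)^-1 (powR_ge0 _ _) ler01.
rewrite !invr_gt0 s0 t0 !invrK subrKC => /(_ erefl erefl erefl).
by rewrite mulr1 powR1 mul1r -powRrM divff ?gt_eqF// powRr1// addrC [z * s]mulrC.
Qed.

(** Squared differences are rescaled by their admissible mean [V / N] before the tangent bound;
    summed over T it gives at most [(V / N)^(q/2) * N], which is the right side. *)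
Lemma dq_le (q : R) n (t u : n.-tuple R) (T : {set 'I_n}) (N V : R) :
  0 < q <= 2 -> (forall i, i \notin T -> tnth t i = tnth u i) ->
  #|T|%:R <= N -> 0 < N -> 0 < V -> sqdist t u <= V ->
  dq q t u <= N `^ (1 - q / 2) * V `^ (q / 2).
Proof.
move=> /andP[q0 q2] tuT TN N0 V0 tuV; set s := q / 2.
have s0 : 0 < s by rewrite divr_gt0.
have s1 : s <= 1 by rewrite ler_pdivrMr// mul1r.
have a0 : 0 < V / N by rewrite divr_gt0.
have as0 : 0 < (V / N) `^ s by rewrite powR_gt0.
have termE i : `|tnth t i - tnth u i| `^ q =
    (V / N) `^ s * ((tnth t i - tnth u i) ^+ 2 / (V / N)) `^ s.
  rewrite -powRM ?divr_ge0 ?sqr_ge0 ?ltW// mulrC divfK ?gt_eqF//.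
  by rewrite -[X in X `^ s]real_normK ?num_real// -powR_mulrn// -powRrM mulrC divfK.
have -> : N `^ (1 - s) * V `^ s = (V / N) `^ s * N.
  rewrite powRM ?invr_ge0 ?ltW// -powR_inv1 ?ltW// -powRrM mulN1r -mulrA.
  rewrite -[X in V `^ s * (_ * X)](powRr1 (ltW N0)) -powRD; last by rewrite (gt_eqF N0) implybT.
  by rewrite mulrC addrC.
apply: (@le_trans _ _ ((V / N) `^ s * \sum_(i in T)
    (1 - s + s * ((tnth t i - tnth u i) ^+ 2 / (V / N))))).
  rewrite /dq mulr_sumr [leRHS]big_mkcond; apply: ler_sum => i _; case: ifPn => iT.
    rewrite termE ler_pM2l// powR_tangent ?s0//.
    by rewrite divr_ge0 ?sqr_ge0// ltW.
  by rewrite tuT// subrr normr0 powR0// gt_eqF.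
rewrite ler_pM2l// big_split/= sumr_const -mulr_sumr -mulr_suml.
have sqT : \sum_(i in T) (tnth t i - tnth u i) ^+ 2 <= V.
  apply: le_trans tuV; rewrite big_mkcond; apply: ler_sum => i _.
  by case: ifP => // _; exact: sqr_ge0.
rewrite -[X in X + _]mulr_natl.
rewrite [leRHS](_ : _ = N * (1 - s) + s * N); last by ring.
apply: lerD; first by rewrite ler_wpM2r// subr_ge0.
rewrite ler_pM2l// ler_pdivrMr// [N * _]mulrC divfK// gt_eqF//.
Qed.

End power_distance.

(** * Logarithm of a binomial coefficient *)

Section binomial_log.
Context {R : realType}.

(** This is [bin_exp_le] at [delta = n / p]: the first factor is at most [(e n / p)^p] since
    [1 + n / p <= 2 n / p], and the second, [(1 + p / n)^(n - p)], is at most [e^p]. *)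
Lemma bin_le_expR (n p : nat) : (0 < p <= n)%N ->
  'C(n, p)%:R <= expR (p%:R * ln (n%:R / p%:R) + 2 * p%:R) :> R.
Proof.
move=> /andP[p0 pn]; have n0 := leq_trans p0 pn.
have np0 : 0 < n%:R / p%:R :> R by rewrite divr_gt0// ltr0n.
have np1 : 1 <= n%:R / p%:R :> R by rewrite ler_pdivlMr ?ltr0n// mul1r ler_nat.
rewrite -[X in 'C(X, p)](subnK pn); apply: le_trans (bin_exp_le (n - p) p np0) _.
have -> : p%:R * ln (n%:R / p%:R) + 2 * p%:R =
  p%:R * (1 + ln (n%:R / p%:R)) + p%:R :> R by ring.
rewrite expRD; apply: ler_pM.
- by rewrite exprn_ge0// addr_ge0// ltW.
- by rewrite exprn_ge0// addr_ge0// invr_ge0 ltW.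
- rewrite expRM_natl lerXn2r ?nnegrE ?expR_ge0//.
  rewrite expRD lnK ?posrE//.
  have e2 : 2 <= expR 1 :> R by apply: le_trans (expR_ge1Dx _).
  apply: le_trans (ler_wpM2r (ltW np0) e2).
  by rewrite mulrDl mul1r lerD2r.
- apply: (@le_trans _ _ (expR ((n%:R / p%:R)^-1) ^+ (n - p))).
    by rewrite lerXn2r ?nnegrE ?expR_ge0//; exact: expR_ge1Dx.
  rewrite -expRM_natl ler_expR invf_div mulrCA ger_pMr ?ltr0n//.
  by rewrite ler_pdivrMr ?ltr0n// mul1r ler_nat leq_subr.
Qed.

End binomial_log.

(** * Explicit rates and the choice of constants *)

Section rates.
Context {R : realType}.

(** Squeezing; nonemptiness matters because the supremum of the empty set is [-oo]. *)
Lemma ereal_sup_cvg0 (E : nat -> set (\bar R)) (b : nat -> R) :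
  (forall n, E n !=set0) ->
  (\forall n \near \oo, forall e, E n e -> (0 <= e <= (b n)%:E)%E) ->
  b n @[n --> \oo] --> (0 : R) -> ereal_sup (E n) @[n --> \oo] --> 0%E.
Proof.
move=> E0 Eb b0; apply: (@squeeze_cvge _ _ _ _ (cst 0%E) _ (fun n => (b n)%:E)).
- near=> n; have Ebn : forall e, E n e -> (0 <= e <= (b n)%:E)%E by near: n.
  apply/andP; split.
    have [e Ee] := E0 n; have /andP[e0 _] := Ebn e Ee.
    by apply: le_trans e0 _; exact: ereal_sup_ubound.
  by apply: ge_ereal_sup => e /Ebn/andP[].
- exact: cvg_cst.
- by apply: cvg_EFin => //; exact: nearW.
Unshelve. all: by end_near. Qed.

Lemma exists_geometric_le (rho Lambda : R) : 0 < rho < 1 -> 0 < Lambda ->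
  exists m, Lambda * rho ^+ m <= 2^-1.
Proof.
move=> /andP[r0 r1] L0.
have /cvgrPdist_lt /(_ ((2 * Lambda)^-1)) : rho ^+ n @[n --> \oo] --> (0 : R).
  by apply: cvg_expr; rewrite gtr0_norm.
case; first by rewrite invr_gt0 mulr_gt0.
move=> m _ /(_ m (leqnn m)) /=; rewrite sub0r normrN gtr0_norm ?exprn_gt0// => Hm.
exists m; rewrite -ler_pdivlMl// (le_trans (ltW Hm))// invfM mulrC.
exact: lexx.
Qed.

(** With [K = (m + 1) p] the exponent [K + 1 - p] is [m p + 1], so p factors [Lambda * rho ^ m],
    each at most 1/2, can be formed. *)
Lemma geometric_rate (Cst rho Lambda : R) m p : 0 < Cst -> 0 < rho < 1 ->
  0 < Lambda -> Lambda * rho ^+ m <= 2^-1 ->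
  Cst / (1 - rho) * Lambda ^+ p * rho ^+ ((m.+1 * p).+1 - p) <=
  Cst / (1 - rho) * 2^-1 ^+ p.
Proof.
move=> C0 /andP[r0 r1] L0 Hm.
have -> : ((m.+1 * p).+1 - p = (m * p).+1)%N by rewrite mulSn -addnS addKn.
rewrite -mulrA ler_pM2l; last by rewrite divr_gt0// subr_gt0.
apply: (@le_trans _ _ ((Lambda * rho ^+ m) ^+ p)).
  rewrite exprMn -exprM ler_pM2l ?exprn_gt0// exprS ger_pMl ?exprn_gt0//.
  exact: ltW.
rewrite lerXn2r// nnegrE ?invr_ge0//.
by rewrite mulr_ge0 ?exprn_ge0// ltW.
Qed.

Lemma exists_superset n (S : {set 'I_n}) p : (#|S| <= p <= n)%N ->
  exists2 T : {set 'I_n}, S \subset T & #|T| = p.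
Proof.
move=> /andP[Sp]; rewrite -(subnKC Sp); elim: (p - _)%N => [|k IH] pn.
  by exists S => //; rewrite addn0.
have [T ST Tk] := IH (leq_trans (leq_add (leqnn _) (leqnSn k)) pn).
have [i iT] : exists i, i \notin T.
  apply/existsP; rewrite -negb_forall; apply/negP => /forallP TT.
  have : (#|T| = n)%N.
    by rewrite -[RHS]card_ord; apply: eq_card => i; rewrite TT.
  by move=> Tn; move: pn; rewrite addnS -Tk Tn ltnn.
exists (i |: T)%SET; last by rewrite cardsU1 iT Tk addnS.
by apply: fintype.subset_trans ST _; exact: finset.subsetUr.
Qed.

Lemma measurable_dq_gt (q a : R) n (u : n.-tuple R) :
  measurable [set t : n.-tuple R | a < dq q t u].
Proof.
have mdq : measurable_fun setT (fun t : n.-tuple R => dq q t u).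
  apply: measurable_sum => i.
  apply: (measurableT_comp (f := fun y : R => y `^ q)); first exact: measurable_powR.
  apply: measurableT_comp => //; apply: measurable_funB => //.
  exact: measurable_tnth.
have -> : [set t : n.-tuple R | a < dq q t u] = (fun t => dq q t u) @^-1` `]a, +oo[.
  by apply/seteqP; split => t /=; rewrite in_itv/= andbT.
by rewrite -[X in measurable X]setTI; apply: mdq.
Qed.

(** All exponents are multiples of [p] or [p log (n/p)], both at most [r2]. In the equation for [L]
    the terms before 5 pay for noise, slabs and Gaussian integrals; the 5 pays for the right side: 1
    for [exp (- p)], 1 for [w p], and 3 for the binomial coefficient. *)
Lemma set_weight_rate n (w : dim_prior R n) (S : {set 'I_n}) (p m : nat)
    (c1 r2 L G : R) :
  (0 < p <= n)%N -> #|S| = p -> 0 <= c1 -> 1 <= G -> p%:R <= r2 ->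
  p%:R * ln (n%:R / p%:R) <= r2 -> ln (1 / w p) <= r2 ->
  11 / 64 * L =
    4 * m.+2%:R + 12 + 3 * c1 * m.+2%:R + c1 + m.+1%:R * ln G + 5 ->
  expR (4 * ((m.+1 * p + p)%:R * - ln (p%:R / n%:R) + 3 * p%:R) +
        3 * c1 * (m.+1 * p + p)%:R + c1 * p%:R - 11 / 64 * (L * r2)) *
    G ^+ (m.+1 * p) <= expR (- p%:R) * set_weight w S.
Proof.
move=> /andP[p0 pn] Sp c10 G1 pr plr wr LE.
have G0 : 0 < G by exact: lt_le_trans G1.
have n0 : (0 < n)%N by exact: leq_trans pn.
have wp0 : 0 < w p by exact: dim_prior_gt0.
have lE : - ln (p%:R / n%:R) = ln (n%:R / p%:R) :> R.
  by rewrite -lnV ?invf_div// posrE divr_gt0// ltr0n.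
set l := ln (n%:R / p%:R) in plr lE *.
have wge : expR (- r2) <= w p.
  rewrite -[leRHS]lnK ?posrE// ler_expR.
  by move: wr; rewrite div1r lnV ?posrE// lerNl.
have Cge : expR (- (p%:R * l + 2 * p%:R)) <= ('C(n, p)%:R)^-1.
  rewrite expRN lef_pV2 ?posrE ?expR_gt0 ?ltr0n ?bin_gt0//.
  by apply: bin_le_expR; rewrite p0.
have GK : G ^+ (m.+1 * p) = expR ((m.+1 * p)%:R * ln G).
  by rewrite expRM_natl lnK ?posrE.
apply: (@le_trans _ _ (expR (- p%:R) * (expR (- r2) * expR (- (p%:R * l + 2 * p%:R))))).
  rewrite lE GK -!expRD ler_expR.
  have -> : (m.+1 * p + p)%:R = m.+2%:R * p%:R :> R.
    by rewrite -natrM; congr (_%:R); rewrite [in RHS]mulSn addnC.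
  rewrite natrM.
  have LrE : 11 / 64 * (L * r2) = (11 / 64 * L) * r2 by rewrite mulrA.
  rewrite LrE LE.
  have lnG0 : 0 <= ln G by exact: ln_ge0.
  have h1 : m.+2%:R * (p%:R * l) <= m.+2%:R * r2 by rewrite ler_wpM2l.
  have h2 : c1 * m.+2%:R * p%:R <= c1 * m.+2%:R * r2 by rewrite ler_wpM2l// mulr_ge0.
  have h3 : c1 * p%:R <= c1 * r2 by rewrite ler_wpM2l.
  have h4 : m.+1%:R * ln G * p%:R <= m.+1%:R * ln G * r2 by rewrite ler_wpM2l// mulr_ge0.
  lra.
rewrite ler_wpM2l ?expR_ge0// /set_weight Sp.
by apply: ler_pM => //; exact: expR_ge0.
Qed.

(** By contraposition: the two vectors differ on at most [(m + 2) p] coordinates, so [dq_le]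
    applies. The powers of [m + 2] and [L] it yields have exponents at most 1 and bases at least 1,
    hence are absorbed by [(m + 2) L <= M]. *)
Lemma sqdist_rate n (t u : n.-tuple R) (q M L r : R) (p m : nat) :
  0 < q <= 2 -> (0 < p)%N -> (#|supp t| <= m.+1 * p)%N -> (#|supp u| <= p)%N ->
  1 <= L -> 0 < r -> m.+2%:R * L <= M ->
  M * (r `^ q) * (p%:R `^ (1 - q / 2)) < dq q t u -> L * r ^+ 2 <= sqdist t u.
Proof.
move=> q02 p0 tK up L1 r0 LM Mdq; rewrite leNgt; apply/negP => tuV.
have [q0 q2] := andP q02.
have V0 : 0 < L * r ^+ 2 by rewrite mulr_gt0 ?exprn_gt0// (lt_le_trans _ L1).
have N0 : 0 < (m.+2 * p)%:R :> R by rewrite ltr0n muln_gt0.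
have T0 : #|(supp t :|: supp u)%SET|%:R <= (m.+2 * p)%:R :> R.
  rewrite ler_nat cardsU (leq_trans (leq_subr _ _))//.
  by rewrite mulSn addnC leq_add.
have tuT i : i \notin (supp t :|: supp u)%SET -> tnth t i = tnth u i.
  by rewrite !finset.inE negb_or !negbK => /andP[/eqP -> /eqP ->].
have := dq_le q02 tuT T0 N0 V0 (ltW tuV).
move=> /(lt_le_trans Mdq); rewrite ltNge => /negP; apply.
have s1 : 0 <= 1 - q / 2 by rewrite subr_ge0 ler_pdivrMr// mul1r.
have L0 : 0 <= L by exact: le_trans L1.
rewrite natrM powRM// (powRM _ L0) ?exprn_ge0 ?(ltW r0)//.
have -> : (r ^+ 2) `^ (q / 2) = r `^ q.
  by rewrite -powR_mulrn ?ltW// -powRrM mulrC divfK.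
have m1 : m.+2%:R `^ (1 - q / 2) <= m.+2%:R :> R.
  rewrite -[leRHS]powRr1// ler_powR ?ler1n//.
  by rewrite lerBlDr lerDl divr_ge0// ltW.
have Lq : L `^ (q / 2) <= L.
  by rewrite -[leRHS]powRr1// ler_powR// ler_pdivrMr// mul1r.
apply: (@le_trans _ _ (m.+2%:R * L * (r `^ q * p%:R `^ (1 - q / 2)))).
  rewrite mulrACA [X in _ * X <= _]mulrC ler_wpM2r ?mulr_ge0 ?powR_ge0//.
  by apply: ler_pM; rewrite ?powR_ge0.
by rewrite -[leRHS]mulrA ler_wpM2r// mulr_ge0// powR_ge0.
Qed.

End rates.

(** * Choice of the constants and passage to the limit *)

Theorem theorem2p4 (R : realType)
  (p : nat -> nat)
  (p_bounds : forall n, (1 <= n)%N -> (1 <= p n <= n)%N)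
  (pi_n : forall n, dim_prior R n)
  (g : forall n k, prob_density R k)
  (D c1 C m1 : R)
  (D_gt0 : 0 < D) (D_lt1 : D < 1)
  (pi_n_decrease : forall n k, (1 <= k <= n)%N -> pi_n n k <= D * pi_n n k.-1)
  (g_second_moment : forall n (S : {set 'I_n}),
    (second_moment (g n #|S|) < +oo)%E)
  (g_log_lipschitz : forall n (S : {set 'I_n}) (t t' : #|S|.-tuple R),
    (lne (g n #|S| t)%:E - lne (g n #|S| t')%:E
     <= (c1 * #|S|%:R + 64^-1 * enorm (tsub t t') ^+ 2)%:E)%E)
  (g_log_proj : forall n (S S' : {set 'I_n}), S' \subset S ->
    forall theta : n.-tuple R,
    (`| lne (g n #|S| (coord_proj S theta))%:E - lne (g n #|S'| (coord_proj S' theta))%:E |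
     <= (c1 * #|S|%:R + 64^-1 * enorm (coord_proj (S :\: S')%SET theta) ^+ 2)%:E)%E)
  (C_gt0 : 0 < C) (m1_gt0 : 0 < m1)
  (gamma : forall n (S : {set 'I_n}), prob_density R #|S|)
  (g_ratio : forall n (S1 S2 : {set 'I_n}), S1 \subset (~: S2)%SET ->
    forall theta2 : #|S2|.-tuple R,
    (ereal_sup [set (g n #|(S1 :|: S2)%SET| (coord_proj (S1 :|: S2)%SET theta)
                     / g n #|S1| (coord_proj S1 theta))%:E
               | theta in [set theta : n.-tuple R | coord_proj S2 theta = theta2]]
     <= (C * m1 ^+ (#|S1| + #|S2|) * gamma n S2 theta2)%:E)%E)
  (Dm1_lt1 : D * m1 < 1) :
  (exists M : R, 0 < M /\
    (p n @[n --> \oo] --> \oo ->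
     ereal_sup [set ('E_(normal_tuple theta0)[fun x => (
         posterior (pi_n n) (g n) x
           [set theta | M * (p n)%:R < #|supp theta|%:R])%R])%E
       | theta0 in @l0 R n (p n)] @[n --> \oo] --> 0%E)) /\
  (forall (q : R) (r : nat -> R), 0 < q <= 2 ->
    (forall n, (1 <= n)%N -> 0 < r n) ->
    (forall n, (1 <= n)%N ->
      Num.max ((p n)%:R * ln (n%:R / (p n)%:R)) (ln (1 / pi_n n (p n)))
      <= r n ^+ 2) ->
    exists M0 : R, forall M : R, M0 <= M ->
      p n @[n --> \oo] --> \oo ->
      (p n)%:R / n%:R @[n --> \oo] --> (0 : R) ->
      ereal_sup [set ('E_(normal_tuple theta0)[fun x => (
          posterior (pi_n n) (g n) x
            [set theta | M * (r n `^ q) * ((p n)%:R `^ (1 - q / 2))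
                         < dq q theta theta0])%R])%E
        | theta0 in @l0 R n (p n)] @[n --> \oo] --> 0%E).
Proof.
(* The sign of [c1] is not prescribed; its nonnegative part gives weaker conditions and is monotone
   in the dimension. *)
pose c := Num.max c1 0.
have c0 : 0 <= c by rewrite le_max lexx orbT.
have expR_c n (S : {set 'I_n}) (s : R) :
    expR (c1 * #|S|%:R + s) <= expR (c * #|S|%:R + s).
  by rewrite ler_expR lerD2r ler_wpM2r// le_max lexx.
have g_lip n (S : {set 'I_n}) t u : slab_density (g n) S t <=
    slab_density (g n) S u *
    expR (c * #|S|%:R + 64^-1 * \sum_(i in S) (tnth t i - tnth u i) ^+ 2).
  have := lne_sub_le (prob_density_ge0 _ _) (prob_density_ge0 _ _)
    (g_log_lipschitz n S (coord_proj S t) (coord_proj S u)).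
  rewrite enorm_tsub_coord_proj => /le_trans; apply.
  by rewrite ler_wpM2l ?slab_density_ge0.
have g_proj n (S T : {set 'I_n}) t : S \subset T ->
    slab_density (g n) T t <= slab_density (g n) S t *
      expR (c * #|T|%:R + 64^-1 * \sum_(i in (T :\: S)%SET) tnth t i ^+ 2) /\
    slab_density (g n) S t <= slab_density (g n) T t *
      expR (c * #|T|%:R + 64^-1 * \sum_(i in (T :\: S)%SET) tnth t i ^+ 2).
  move=> ST.
  have [] := lne_dist_le (prob_density_ge0 _ _) (prob_density_ge0 _ _)
    (g_log_proj n T S ST t).
  rewrite enorm_coord_proj => H1 H2; split.
    by apply: le_trans H1 _; rewrite ler_wpM2l ?slab_density_ge0.
  by apply: le_trans H2 _; rewrite ler_wpM2l ?slab_density_ge0.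
have g_union n (S1 S2 : {set 'I_n}) theta : (S1 \subset ~: S2)%SET ->
    slab_density (g n) (S1 :|: S2)%SET theta <= C * m1 ^+ (#|S1| + #|S2|) *
      gamma n S2 (coord_proj S2 theta) * slab_density (g n) S1 theta.
  move=> S12; have := slab_density_ge0 (g n) S1 theta.
  rewrite le_eqVlt => /orP[/eqP gS1|gS1].
    (* Where the slab on S1 vanishes the quotient is 0 by convention and carries no information; the
       projection condition forces the slab on the union to vanish as well. *)
    have [H _] := g_proj n S1 (S1 :|: S2)%SET theta (finset.subsetUl _ _).
    by rewrite -gS1 mulr0; move: H; rewrite -gS1 mul0r.
  rewrite -ler_pdivrMr// -lee_fin.
  apply: le_trans (g_ratio n S1 S2 S12 (coord_proj S2 theta)).
  by apply: ereal_sup_ubound; exists theta.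
pose x := D * m1; have x0 : 0 < x by rewrite mulr_gt0.
(* Chosen so that [x * (1 + delta)] is the midpoint of [x] and 1. *)
pose delta := (1 - x) / (2 * x).
have delta0 : 0 < delta by rewrite divr_gt0 ?subr_gt0// mulr_gt0.
have rhoE : D * m1 * (1 + delta) = (1 + x) / 2.
  by rewrite -/x /delta; field; rewrite gt_eqF.
have rho1 : D * m1 * (1 + delta) < 1 by rewrite rhoE -/x; move: Dm1_lt1; rewrite -/x; lra.
have rho01 : 0 < D * m1 * (1 + delta) < 1.
  by rewrite rho1 andbT rhoE; lra.
have Lambda0 : 0 < Num.max 1 m1 * (1 + delta^-1).
  by rewrite mulr_gt0 ?addr_gt0 ?invr_gt0// lt_max ltr01.
have [m Hm] := exists_geometric_le rho01 Lambda0.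
have Kp n : (p n <= m.+1 * p n)%N by rewrite leq_pmull.
have rate n := geometric_rate (p n) C_gt0 rho01 Lambda0 Hm.
have half_cvg : p n @[n --> \oo] --> \oo ->
    C / (1 - D * m1 * (1 + delta)) * 2^-1 ^+ p n @[n --> \oo] --> (0 : R).
  move=> poo; rewrite -[X in _ --> X](mulr0 (C / (1 - D * m1 * (1 + delta)))).
  apply: cvgMr.
  have := @cvg_comp _ _ _ p (fun k => 2^-1 ^+ k : R) _ _ _ poo; apply.
  by apply: cvg_expr; rewrite gtr0_norm ?invr_gt0// invf_lt1// ltr1n.
have l0_neq0 n : @l0 R n (p n) !=set0.
  exists [tuple 0 | _ < n]; rewrite /l0 /= eq_card0// => i.
  by rewrite finset.inE tnth_mktuple eqxx.
have E_ge0 n (theta0 : n.-tuple R) B :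
    (0 <= 'E_(normal_tuple theta0)[fun y => posterior (pi_n n) (g n) y B])%E.
  by rewrite unlock; apply: integral_ge0 => y _; rewrite lee_fin posterior_ge0.
split.
  exists m.+1%:R; split; first by rewrite ltr0n.
  move=> poo; apply: (ereal_sup_cvg0 _ _ (half_cvg poo)).
    by move=> n; have [t tl0] := l0_neq0 n; eexists; exists t.
  near=> n => _ [theta0 theta0p <-]; rewrite E_ge0/=.
  have n1 : (1 <= n)%N by near: n; exists 1%N.
  (* As [M = m + 1] is an integer, the real threshold is the natural number [K = (m + 1) p]. *)
  rewrite (_ : [set theta | _] =
    [set theta : n.-tuple R | (m.+1 * p n < #|supp theta|)%N]); last first.
    by apply/seteqP; split => theta /=; rewrite -natrM ltr_nat.
  have S0p : (#|supp theta0| <= p n <= m.+1 * p n)%N by rewrite Kp andbT.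
  apply: le_trans (expectation_posterior_dimension_le D_gt0 (pi_n_decrease n)
    m1_gt0 C_gt0 (g_union n) delta0 rho1 S0p) _.
  by rewrite lee_fin.
move=> q r q02 r_gt0 r_ge.
pose G : R := Num.sqrt (pi / 16^-1).
have G1 : 1 <= G.
  by have pi2 := pi_ge2 R; rewrite /G -[leLHS]sqrtr1 ler_sqrt; lra.
(* The total coefficient of [r n ^ 2] required by [set_weight_rate]; [L] undoes the factor 11/64. *)
pose A : R := 4 * m.+2%:R + 12 + 3 * c * m.+2%:R + c + m.+1%:R * ln G + 5.
pose L := 64 / 11 * A.
have LE : 11 / 64 * L = A by rewrite /L; field.
have L1 : 1 <= L.
  have h1 : 0 <= m.+2%:R :> R by [].
  have h2 : 0 <= c * m.+2%:R by rewrite mulr_ge0.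
  have h3 : 0 <= m.+1%:R * ln G by rewrite mulr_ge0// ln_ge0.
  rewrite /L /A; lra.
exists (m.+2%:R * L) => M LM poo pn0.
(* The three errors: large supports, exceptional noise, and small supports far from [theta0]. *)
pose b n := C / (1 - D * m1 * (1 + delta)) * 2^-1 ^+ p n +
  (expR (- (p n)%:R) + expR (- (p n)%:R)).
have b0 : b n @[n --> \oo] --> (0 : R).
  have e0 : expR (- (p n)%:R) @[n --> \oo] --> (0 : R).
    have := @cvg_comp _ _ _ p (fun k => expR (- k%:R) : R) _ _ _ poo; apply.
    rewrite (_ : (fun _ => _) = (fun k => expR (-1) ^+ k : R)); last first.
      by apply/funext => k; rewrite -expRM_natl mulrN1.
    by apply: cvg_expr; rewrite gtr0_norm ?expR_gt0// expR_lt1 ltrN10.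
  rewrite -[X in _ --> X](addr0 0); apply: cvgD; first exact: half_cvg.
  by rewrite -[X in _ --> X](addr0 0); apply: cvgD.
apply: (ereal_sup_cvg0 _ _ b0).
  by move=> n; have [t tl0] := l0_neq0 n; eexists; exists t.
near=> n => _ [theta0 theta0p <-]; rewrite E_ge0/=.
have n1 : (1 <= n)%N by near: n; exists 1%N.
have [p1 pn] := andP (p_bounds n n1).
(* Sparsity makes [log (n/p)] at least 1 eventually, so that [p <= p log (n/p) <= r^2]. *)
have pne : (p n)%:R / n%:R <= expR (-1) :> R.
  near: n; move/cvgrPdist_le : pn0 => /(_ (expR (-1)) (expR_gt0 _)).
  apply: filterS => k; rewrite sub0r normrN; apply: le_trans.
  exact: ler_norm.
(* The true support may be smaller than [p n]; it is enlarged to size exactly [p n], the dimension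
   whose prior mass the rate controls. *)
have [Ss S0Ss Ssp] := @exists_superset n (supp theta0) (p n) (introT andP (conj theta0p pn)).
have := r_ge n n1; rewrite ge_max => /andP[plr wr].
have pr : (p n)%:R <= r n ^+ 2.
  apply: le_trans plr; rewrite ler_peMr//.
  have pn_gt0 : 0 < (p n)%:R / n%:R :> R by rewrite divr_gt0// ltr0n.
  rewrite -[leLHS]opprK lerNl -lnV ?posrE ?invr_gt0//; last first.
    by rewrite divr_gt0// ltr0n.
  by rewrite invf_div -ler_expR lnK ?posrE.
have pK : (0 < p n <= m.+1 * p n)%N by rewrite p1 Kp.
have pp : (0 < p n <= n)%N by rewrite p1.
have eta := set_weight_rate pp Ssp c0 G1 pr plr wr LE.
apply: le_trans (@expectation_posterior_distance_le _ _ _ _ _ _ _ _ c theta0 Ss D_gt0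
  (pi_n_decrease n) m1_gt0 C_gt0 (g_union n) c0 (g_lip n) _ _ S0Ss delta (p n)
  (m.+1 * p n)%N _ (L * r n ^+ 2) (expR (- (p n)%:R)) delta0 rho1 Ssp pK
  (measurable_dq_gt _ _ _) _ (expR_ge0 _) eta) _.
- by move=> S T t /(g_proj n S T t)[].
- by move=> S T t /(g_proj n S T t)[].
- by move=> t tK; apply: (@sqdist_rate _ _ _ _ q M L (r n) (p n) m) => //; exact: r_gt0.
by rewrite lee_fin lerD2r.
Unshelve. all: by end_near. Qed.
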